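(* Let $(\bar{M}, g)$ be a compact Riemannian manifold with smooth boundary $\partial M$, with $n = \dim \bar{M} \geqslant 3$. Then there exists a metric $\tilde{g}$ conformal to $g$ whose mean curvature $\tilde{h}$ on $\partial M$ satisfies $\tilde{h} > 0$ everywhere on $\partial M$.
   Context: A metric conformal to $g$ is a metric of the form $\tilde{g} = u^{p-2} g$ with $p = \frac{2n}{n-2}$ and $u \in C^{\infty}(\bar{M})$, $u > 0$ on $\bar{M}$. The mean curvature is taken with respect to the outward unit normal $\nu$, with sign and normalization such that under $\tilde{g} = e^{2f} g$ it transforms as $\tilde{h} = e^{-f}\left(h_{g} + \frac{\partial f}{\partial \nu}\right)$ (the average of the principal curvatures, positive for the Euclidean ball). *)

(* Defs.v *)
From HB Require Import structures.
From mathcomp Require Import all_boot all_order all_algebra.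
From mathcomp Require Import all_classical all_reals all_analysis.

Set Implicit Arguments.
Unset Strict Implicit.
Unset Printing Implicit Defensive.

Import Order.TTheory GRing.Theory Num.Theory.
Import numFieldNormedType.Exports.

Local Open Scope classical_set_scope.
Local Open Scope ring_scope.

(* The dimension of all manifolds below is [m.+1]; coordinate [ord0] is the one
   normal to the boundary, [lift ord0 a] (a : 'I_m) are the tangential ones. *)

Section Calculus.
Context {R : realType} {m : nat}.
Implicit Types (f F : 'rV[R]_m.+1 -> R) (x : 'rV[R]_m.+1) (A U : set 'rV[R]_m.+1).

Definition half_space : set 'rV[R]_m.+1 := [set x | 0 <= x ord0 ord0].

Definition e_ (i : 'I_m.+1) : 'rV[R]_m.+1 := delta_mx ord0 i.

Definition iter_partial (s : seq 'I_m.+1) F : 'rV[R]_m.+1 -> R :=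
  foldr (fun i G => 'D_(e_ i) G) F s.

(* C^oo on an open set: all iterated partial derivatives exist and are
   continuous. *)
Definition smooth_open U F : Prop :=
  forall (s : seq 'I_m.+1) x, U x ->
    {for x, continuous (iter_partial s F)} /\
    forall i, derivable (iter_partial s F) x (e_ i).

(* C^oo on an arbitrary set: local smooth extendability to open sets. *)
Definition smooth_on A f : Prop :=
  forall x, A x -> exists (U : set 'rV[R]_m.+1) (F : 'rV[R]_m.+1 -> R),
    [/\ open U, U x, smooth_open U F & forall y, A y -> U y -> F y = f y].

(* Partial derivative within the half-space: the usual one in the interior, and
   on the boundary the one-sided difference quotient in the normal direction
   (the common value of the partial derivative of all smooth extensions). *)
Definition pderiv (i : 'I_m.+1) f x : R :=
  lim ((fun h : R => h^-1 * (f (x + h *: e_ i) - f x)) @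
       within [set h | half_space (x + h *: e_ i)] (0 : R)^').

End Calculus.

Section Manifold.
Variables (R : realType) (m : nat) (M : topologicalType).

Record chart := Chart {
  dom : set M ;
  coord : M -> 'rV[R]_m.+1 ;
  param : 'rV[R]_m.+1 -> M ;
  dom_open : open dom ;
  coordK : forall p, dom p -> param (coord p) = p ;
  coord_continuous : {within dom, continuous coord} ;
  param_continuous : {within coord @` dom, continuous param} ;
  coord_image : exists2 O : set 'rV[R]_m.+1,
    open O & coord @` dom = O `&` half_space
}.

Definition transition (c c' : chart) (x : 'rV[R]_m.+1) : 'rV[R]_m.+1 :=
  coord c' (param c x).

Record bmanifold := BManifold {
  atlas : set chart ;
  atlas_cover : forall p, exists2 c, atlas c & dom c p ;
  atlas_smooth : forall c c', atlas c -> atlas c' -> forall k : 'I_m.+1,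
    smooth_on (coord c @` (dom c `&` dom c'))
      (fun x => transition c c' x ord0 k) ;
  bmanifold_hausdorff : hausdorff_space M ;
  bmanifold_second_countable : @second_countable M
}.

Variable X : bmanifold.

Definition boundary : set M :=
  [set p | exists c, [/\ atlas X c, dom c p & coord c p ord0 ord0 = 0]].

Definition smooth_fun (u : M -> R) : Prop :=
  forall c, atlas X c -> smooth_on (coord c @` dom c) (u \o param c).

(* (i, k) entry: d y^k / d x^i, for x the coordinates of c, y those of c'. *)
Definition jacobian_mx (c c' : chart) (p : M) : 'M[R]_m.+1 :=
  \matrix_(i, k) pderiv i (fun x => transition c c' x ord0 k) (coord c p).

(* A smooth, symmetric, positive definite covariant 2-tensor, given by its
   components in the charts of the atlas. *)
Record riemannian_metric := RiemannianMetric {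
  components :> chart -> M -> 'M[R]_m.+1 ;
  metric_sym : forall c p, atlas X c -> dom c p ->
    (components c p)^T = components c p ;
  metric_posdef : forall c p, atlas X c -> dom c p ->
    forall v : 'rV[R]_m.+1, v != 0 ->
    0 < (v *m components c p *m v^T) ord0 ord0 ;
  metric_smooth : forall c, atlas X c -> forall i j,
    smooth_on (coord c @` dom c) (fun x => components c (param c x) i j) ;
  metric_tensor : forall c c' p, atlas X c -> atlas X c' ->
    dom c p -> dom c' p ->
    components c p =
      jacobian_mx c c' p *m components c' p *m (jacobian_mx c c' p)^T
}.

(* The exponent [p] of the conformal factor [u ^ (p - 2)]. *)
Definition conformal_p : R := 2 * m.+1%:R / (m.+1%:R - 2).

Definition conformal (g gt : riemannian_metric) : Prop :=
  exists u : M -> R,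
    [/\ smooth_fun u, forall p, 0 < u p &
        forall c p, atlas X c -> dom c p ->
          gt c p = (u p `^ (conformal_p - 2)) *: g c p].

End Manifold.

(* Geometry of a metric G on (an open piece of) the half-space, given by its
   component functions. *)
Section LocalGeometry.
Context {R : realType} {m : nat}.
Variable G : 'rV[R]_m.+1 -> 'M[R]_m.+1.
Implicit Types x : 'rV[R]_m.+1.

(* Gamma^k_{ij} of the Levi-Civita connection. *)
Definition christoffel x (k i j : 'I_m.+1) : R :=
  2^-1 * \sum_l invmx (G x) k l *
    (pderiv i (fun y => G y j l) x + pderiv j (fun y => G y i l) x
     - pderiv l (fun y => G y i j) x).

(* - grad x^0 / |grad x^0|, as the manifold lies in {x^0 >= 0}. *)
Definition outward_normal x (k : 'I_m.+1) : R :=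
  - (invmx (G x) k ord0 / Num.sqrt (invmx (G x) ord0 ord0)).

(* II(d_a, d_b) = g(nabla_{d_a} nu, d_b) = - g(nu, nabla_{d_a} d_b), which is
   positive for the Euclidean ball. *)
Definition second_form x : 'M[R]_m :=
  \matrix_(a, b) - \sum_k \sum_l
    G x k l * outward_normal x k * christoffel x l (lift ord0 a) (lift ord0 b).

Definition boundary_metric x : 'M[R]_m :=
  \matrix_(a, b) G x (lift ord0 a) (lift ord0 b).

(* Its eigenvalues are the principal curvatures. *)
Definition shape_operator x : 'M[R]_m :=
  invmx (boundary_metric x) *m second_form x.

Definition local_mean_curvature x : R := m%:R^-1 * \tr (shape_operator x).

End LocalGeometry.

(* Mean curvature of the boundary at the boundary point [p], computed in the
   chart [c] around [p]; the value does not depend on [c]. *)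
Definition mean_curvature (R : realType) (m : nat) (M : topologicalType)
    (X : bmanifold R m M) (g : riemannian_metric X) (c : chart R m M) (p : M)
    : R :=
  local_mean_curvature (fun x => g c (param c x)) (coord c p).

(* Main.v *)
Require Import Defs.
From mathcomp Require Import all_boot all_order all_algebra.
From mathcomp Require Import all_classical all_reals all_analysis.
From mathcomp Require Import ring lra.
Set Implicit Arguments.
Unset Strict Implicit.
Unset Printing Implicit Defensive.
Import Order.TTheory GRing.Theory Num.Theory.
Import numFieldNormedType.Exports.
Import Defs.
Local Open Scope classical_set_scope.
Local Open Scope ring_scope.

(* Take a conformal factor [exp (- kappa * w)] with [w >= 0] smooth and vanishing
   on the boundary.  There it leaves the metric unchanged and shifts the mean
   curvature by a positive multiple of the inward normal derivative of [w].
   Around a boundary point, [w] is a large multiple of a bump function times the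
   normal coordinate; by compactness finitely many such functions add up to one
   that beats the mean curvature of [g] along the whole boundary.  Positivity in
   one chart passes to the others by the transformation law of the Christoffel
   symbols. *)

(** At a boundary point the mean curvature is a positive multiple of the trace of the Christoffel
    symbols [Gamma^0_ab] over the boundary metric, because the unit normal is dual to a multiple of
    the differential of the normal coordinate. A conformal factor equal to one on the boundary
    alters this trace only through its own inward normal derivative. For a nonnegative [w] vanishing
    on the boundary, the normal derivative is never negative, so the contributions of different
    charts add up without cancelling. The constant [kappa] is [p - 2], which makes
    [exp (- kappa * w)] the required power of the positive function [exp (- w)]. Two obstacles shape
    the development. Smoothness means that local extensions have continuous iterated partial
    derivatives, so the chain rule and the symmetry of second derivatives are derived from the mean
    value theorem in one variable. And a boundary point is only known to be placed on the boundary
    by some chart; that every chart around it does so rests on invertible Jacobians, which the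
    tensor law of the metric provides. *)

(** * Directional derivatives as derivatives in one variable *)

Section Lines.
Context {R : realType} {V : normedModType R}.
Implicit Types (f : V -> R) (x v : V).

Lemma growth_rate_line f x v (t : R) :
  (fun h : R => h^-1 *: (((fun s : R => f (x + s *: v)) \o shift t) (h *: (1 : R))
                         - f (x + t *: v))) =
  (fun h : R => h^-1 *: ((f \o shift (x + t *: v)) (h *: v) - f (x + t *: v))).
Proof.
apply/funext => h /=; rewrite [h *: 1]mulr1 scalerDl addrCA; congr (_ *: (f _ - _)).
Qed.

Lemma is_derive_line f x v (t : R) : derivable f (x + t *: v) v ->
  is_derive t 1 (fun s : R => f (x + s *: v)) ('D_v f (x + t *: v)).
Proof.
by move=> df; apply: DeriveDef; rewrite /derivable /derive growth_rate_line.
Qed.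

Lemma is_derive_of_line f x v (l : R) :
  is_derive (0 : R) 1 (fun s : R => f (x + s *: v)) l -> is_derive x v f l.
Proof.
have E := growth_rate_line f x v 0; rewrite scale0r addr0 in E.
by move=> [dl <-]; apply: DeriveDef;
  move: dl; rewrite /derivable /derive ?scale0r ?addr0 E.
Qed.

Lemma is_derive_comp1 f (h : R -> R) x v (dh : R) :
  derivable f x v -> is_derive (f x) 1 h dh ->
  is_derive x v (h \o f) (dh * 'D_v f x).
Proof.
move=> df dh1; apply: is_derive_of_line.
have fx : f x = f (x + 0 *: v) by rewrite scale0r addr0.
rewrite fx in dh1.
apply: (is_derive1_comp (f := h) (g := fun s : R => f (x + s *: v))).
have := @is_derive_line f x v 0; rewrite scale0r addr0; exact.
Qed.

Lemma derivable_ext_near f g x v :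
  (\forall y \near x, f y = g y) -> derivable f x v -> derivable g x v.
Proof. by move=> fg; apply: near_eq_derivable. Qed.

End Lines.

Lemma MVT_derivable (R : realType) (f df : R -> R) (a b : R) : a <= b ->
  (forall x, a <= x <= b -> is_derive x 1 f (df x)) ->
  exists2 c, a <= c <= b & f b - f a = df c * (b - a).
Proof.
move=> ab fd; have [x|| c cab ->] := @MVT_segment R f df a b ab.
- by rewrite in_itv /= => /andP[ax xb]; apply: fd; rewrite !ltW.
- apply: derivable_within_continuous => x; rewrite in_itv /= => xab.
  by have [] := fd _ xab.
- by exists c => //; move: cab; rewrite in_itv.
Qed.

Lemma dist_split (R : realFieldType) (e a b p : R) :
  `|a - p| < e / 2 -> `|b - p| < e / 2 -> `|a - b| <= e.
Proof. by rewrite !ltr_norml ler_norml => /andP[? ?] /andP[? ?]; lra. Qed.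

(** * Chain rule along curves and symmetry of second derivatives *)

Section Partial.
Context {R : realType} {m : nat}.
Local Notation V := 'rV[R]_m.+1.
Implicit Types (F : V -> R) (x y z : V) (U : set V).

Lemma ball_rV x y (r : R) : 0 < r ->
  (forall k, `|x ord0 k - y ord0 k| < r) -> ball x r y.
Proof. by move=> r0 H; split => // i j; rewrite ord1; apply: H. Qed.

Lemma MVT_partial F (i : 'I_m.+1) x (s : R) :
  (forall t, `|t| <= `|s| -> derivable F (x + t *: e_ i) (e_ i)) ->
  exists2 t, `|t| <= `|s| &
    F (x + s *: e_ i) - F x = s * 'D_(e_ i) F (x + t *: e_ i).
Proof.
move=> dF; have [s0|s0] := leP 0 s.
  have [t|c /andP[c0 cs]] := @MVT_derivable R (fun t => F (x + t *: e_ i))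
    (fun t => 'D_(e_ i) F (x + t *: e_ i)) 0 s s0.
    move=> /andP[t0 ts]; apply: is_derive_line; apply: dF.
    by rewrite !ger0_norm.
  rewrite scale0r addr0 subr0 mulrC => ->.
  by exists c => //; rewrite !ger0_norm.
have [t|c /andP[c0 cs]] := @MVT_derivable R (fun t => F (x + t *: e_ i))
  (fun t => 'D_(e_ i) F (x + t *: e_ i)) s 0 (ltW s0).
  move=> /andP[t0 ts]; apply: is_derive_line; apply: dF.
  by rewrite !ler0_norm ?lerN2 ?(ltW s0).
rewrite scale0r addr0 sub0r mulrN mulrC => E.
exists c; first by rewrite !ler0_norm ?lerN2 ?(ltW s0).
by rewrite -opprB E opprK.
Qed.

(** The corners of a staircase from [y] to [z]; consecutive corners differ in one coordinate, where
    the mean value theorem applies. *)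
Let mix (y z : V) (k : nat) : V :=
  \row_j (if (j < k)%N then z ord0 j else y ord0 j).

Let mixS y z (k : 'I_m.+1) :
  mix y z k.+1 = mix y z k + (z ord0 k - y ord0 k) *: e_ k.
Proof.
apply/rowP => j; rewrite !mxE eqxx /= ltnS leq_eqVlt -val_eqE /=.
by have [/val_inj ->|] := eqVneq (j : nat) k; rewrite ?ltnn /= ?mulr1 ?mulr0 ?addr0 1?addrC ?subrK.
Qed.

(* The chain rule is obtained by moving the coordinates one at a time, so that
   only continuity of the partial derivatives of [F] at [y 0] is needed. *)
Lemma is_derive_curve F U (y : R -> V) (dy : 'I_m.+1 -> R) :
  open U -> U (y 0) ->
  (forall z i, U z -> derivable F z (e_ i)) ->
  (forall i, {for y 0, continuous ('D_(e_ i) F)}) ->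
  (forall k, is_derive (0 : R) 1 (fun t => y t ord0 k) (dy k)) ->
  is_derive (0 : R) 1 (F \o y) (\sum_k dy k * 'D_(e_ k) F (y 0)).
Proof.
move=> oU Uy dF cF dyk.
have yc k : (fun t => y t ord0 k) @ (0 : R) --> y 0 ord0 k.
  by apply: differentiable_continuous; apply/derivable1_diffP; case: (dyk k).
have [r r0 rU] : exists2 r : R, 0 < r & ball (y 0) r `<=` U.
  by apply/nbhs_ballP; apply: open_nbhs_nbhs.
have cvgy e : 0 < e -> \forall h \near (0 : R), forall k, `|y 0 ord0 k - y h ord0 k| < e.
  move=> e0; apply: (@filter_forall R _ (fun k h => `|y 0 ord0 k - y h ord0 k| < e) (nbhs (0:R)) _) => k.
  by have /cvgrPdist_lt := yc k; apply.
have H (k : 'I_m.+1) (h : R) : exists xi : V,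
    (forall j, `|y 0 ord0 j - xi ord0 j| <= `|y 0 ord0 j - y h ord0 j|) /\
    ((forall j, `|y 0 ord0 j - y h ord0 j| < r) ->
     F (mix (y 0) (y h) k.+1) - F (mix (y 0) (y h) k) =
     (y h ord0 k - y 0 ord0 k) * 'D_(e_ k) F xi).
  have bd t : `|t| <= `|y h ord0 k - y 0 ord0 k| ->
      forall j, `|y 0 ord0 j - (mix (y 0) (y h) k + t *: e_ k) ord0 j| <=
                `|y 0 ord0 j - y h ord0 j|.
    move=> ht j; rewrite !mxE eqxx /= -val_eqE /=.
    have [/val_inj ->|] := eqVneq (j : nat) k.
      by rewrite ltnn mulr1 opprD addrA subrr sub0r normrN [leRHS]distrC.
    by case: ifP => _ _; rewrite mulr0 addr0 // subrr normr0.
  (* Far from [y 0] the mean value identity is not claimed, and the default [y 0] satisfies the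
     distance bound; thus [xi] is defined for every [h]. *)
  have [hr|hr] := pselect (forall j, `|y 0 ord0 j - y h ord0 j| < r); last first.
    by exists (y 0); split => // j; rewrite subrr normr0.
  have [t tb|t tb E] := @MVT_partial F k (mix (y 0) (y h) k) (y h ord0 k - y 0 ord0 k).
    apply/dF/rU/ball_rV => // j; exact: le_lt_trans (bd _ tb j) (hr j).
  exists (mix (y 0) (y h) k + t *: e_ k); split; first exact: bd.
  by move=> _; rewrite mixS.
pose xi k := projT1 (choice (H k)).
have xiP k h := projT2 (choice (H k)) h; rewrite -/(xi _) in xiP.
have cxi k : xi k h @[h --> (0:R)] --> y 0.
  apply/cvg_ballP => e e0; near=> h; apply: ball_rV => // j.
  apply: le_lt_trans ((xiP k h).1 j) _.
  by have : forall j, `|y 0 ord0 j - y h ord0 j| < e by near: h; exact: cvgy.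
have lim : h^-1 *: (((F \o y) \o shift 0) (h *: (1:R)) - (F \o y) 0) @[h --> (0:R)^']
    --> \sum_k dy k * 'D_(e_ k) F (y 0).
  apply: (@cvg_trans _ ((\sum_k (h^-1 * (y h ord0 k - y 0 ord0 k)) * 'D_(e_ k) F (xi k h))
             @[h --> (0:R)^'])).
    apply: near_eq_cvg; near=> h.
    have hr : forall j, `|y 0 ord0 j - y h ord0 j| < r.
      by near: h; apply: cvg_within; exact: cvgy.
    rewrite /= addr0 [h *: 1]mulr1 /=.
    transitivity (h^-1 * \sum_(0 <= k < m.+1) (F (mix (y 0) (y h) k.+1) - F (mix (y 0) (y h) k))).
      rewrite big_mkord mulr_sumr; apply: eq_bigr => k _.
      by rewrite (xiP k h).2 // mulrA.
    rewrite telescope_sumr //; congr (_ * (F _ - F _)); apply/rowP => j; rewrite !mxE //.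
    by rewrite ltn_ord.
  apply: cvg_big => // [|k _]; first exact: add_continuous.
  apply: cvgM; last first.
    apply: (@cvg_comp _ _ _ (xi k) ('D_(e_ k) F)); last exact: cF.
    exact: cvg_trans (cvg_app _ (cvg_within _)) (cxi k).
  have [dk <-] := dyk k; have := dk; rewrite /derivable /derive.
  set q := (X in cvg (X @ _) -> _) => cq.
  suff -> : (fun h : R => h^-1 * (y h ord0 k - y 0 ord0 k)) = q by exact: cq.
  by apply/funext => h; rewrite /q /= addr0 [h *: 1]mulr1.
apply: DeriveDef; first by apply/cvg_ex; eexists; exact: lim.
exact: (cvg_lim _ lim).
Unshelve. all: by end_near. Qed.

(** The mean value theorem in direction [i], applied to the increment of [F] in direction [j], and
    then once more in direction [j]. The second difference on the left is symmetric in [i] and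
    [j]. *)
Lemma second_difference F (i j : 'I_m.+1) x (s : R) : 0 < s ->
  (forall t u, 0 <= t <= s -> 0 <= u <= s ->
     derivable F (x + t *: e_ i + u *: e_ j) (e_ i) /\
     derivable ('D_(e_ i) F) (x + t *: e_ i + u *: e_ j) (e_ j)) ->
  exists t u, [/\ 0 <= t <= s, 0 <= u <= s &
    F (x + s *: e_ i + s *: e_ j) - F (x + s *: e_ i) -
      (F (x + s *: e_ j) - F x) =
    s * s * 'D_(e_ j) ('D_(e_ i) F) (x + t *: e_ i + u *: e_ j)].
Proof.
move=> s0 dF.
have i0 : 0 <= (0:R) <= s by rewrite lexx ltW.
have is_ : 0 <= s <= s by rewrite lexx ltW.
have [t tb|t tb E1] := @MVT_derivable R
    (fun t => F (x + s *: e_ j + t *: e_ i) - F (x + t *: e_ i))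
    (fun t => 'D_(e_ i) F (x + s *: e_ j + t *: e_ i) - 'D_(e_ i) F (x + t *: e_ i))
    0 s (ltW s0).
  apply: is_deriveB.
    by apply: is_derive_line; rewrite addrAC; have [] := dF t s tb is_.
  by apply: is_derive_line; have [] := dF t 0 tb i0; rewrite scale0r addr0.
have [u ub|u ub E2] := @MVT_derivable R
    (fun u => 'D_(e_ i) F (x + t *: e_ i + u *: e_ j))
    (fun u => 'D_(e_ j) ('D_(e_ i) F) (x + t *: e_ i + u *: e_ j)) 0 s (ltW s0).
  by apply: is_derive_line; have [] := dF t u tb ub.
exists t, u; split => //.
move: E1 E2; rewrite !scale0r !addr0 !subr0 => E1 E2.
rewrite [x + s *: e_ j + t *: _]addrAC E2 in E1.
rewrite [x + s *: e_ i + s *: e_ j]addrAC {}E1.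
have key (D : R) : D * s * s = s * s * D by ring.
exact: key.
Qed.

Lemma near_pair_dist (f g : V -> R) x U (e : R) :
  {for x, continuous f} -> {for x, continuous g} -> 0 < e -> open U -> U x ->
  \forall z \near x, [/\ U z, `|f x - f z| < e & `|g x - g z| < e].
Proof.
move=> /cvgrPdist_lt cf /cvgrPdist_lt cg e0 oU Ux.
have NU : \forall z \near x, U z by exact: open_nbhs_nbhs.
by apply: filterS3 NU (cf _ e0) (cg _ e0) => z; split.
Qed.

(** The same second difference is computed in both orders, so the two mixed derivatives agree at two
    possibly different points close to [x]; their continuity at [x] does the rest. *)
Lemma derive_mixedC F (i j : 'I_m.+1) x U : open U -> U x ->
  (forall z, U z -> derivable F z (e_ i) /\ derivable F z (e_ j) /\
     derivable ('D_(e_ i) F) z (e_ j) /\ derivable ('D_(e_ j) F) z (e_ i)) ->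
  {for x, continuous ('D_(e_ i) ('D_(e_ j) F))} ->
  {for x, continuous ('D_(e_ j) ('D_(e_ i) F))} ->
  'D_(e_ i) ('D_(e_ j) F) x = 'D_(e_ j) ('D_(e_ i) F) x.
Proof.
move=> oU Ux dF c1 c2; apply/eqP; rewrite -subr_eq0 -normr_le0.
apply/ler_addgt0Pl => e e0; rewrite addr0.
have e20 : 0 < e / 2 by rewrite divr_gt0.
have N := near_pair_dist c1 c2 e20 oU Ux.
have /nbhs_ballP[r /= r0 rN] := N.
(* Two steps of length at most [s] keep each coordinate within [2 * s < r], even when [i = j]. *)
pose s := r / 3; have s0 : 0 < s by rewrite divr_gt0.
have B a b t u : 0 <= t <= s -> 0 <= u <= s -> ball x r (x + t *: e_ a + u *: e_ b).
  move=> tb ub; apply: ball_rV => // k.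
  rewrite !mxE eqxx /= -addrA opprD addrA subrr sub0r normrN.
  have -> : r = s + s + s by rewrite /s; field.
  case: (k == a); case: (k == b); rewrite /= ?mulr1 ?mulr0 ?addr0 ?add0r ger0_norm; lra.
have [t u|t [u [tb ub E1]]] := @second_difference F i j x s s0.
  by move=> tb ub; have [/dF[? [_ [? _]]] _ _] := rN _ (B i j _ _ tb ub).
have [t' u'|t' [u' [tb' ub' E2]]] := @second_difference F j i x s s0.
  by move=> tb' ub'; have [/dF[_ [? [_ ?]]] _ _] := rN _ (B j i _ _ tb' ub').
have E : 'D_(e_ j) ('D_(e_ i) F) (x + t *: e_ i + u *: e_ j) =
         'D_(e_ i) ('D_(e_ j) F) (x + t' *: e_ j + u' *: e_ i).
  apply: (@mulfI _ (s * s)); first by rewrite mulf_neq0 ?gt_eqF.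
  apply: etrans (esym E1) (etrans _ E2); rewrite [x + s *: e_ j + s *: e_ i]addrAC.
  have key (a b c d : R) : a - b - (c - d) = a - c - (b - d) by ring.
  exact: key.
have [_ _ b1] := rN _ (B i j _ _ tb ub).
have [_ b2 _] := rN _ (B j i _ _ tb' ub').
rewrite E in b1; exact: (dist_split b2 b1).
Qed.

End Partial.

(** * The flat functions behind smooth bumps *)

Section Flat.
Context {R : realType}.
Implicit Types (k : nat) (t : R).

(** For [k = 0] this is the classical smooth function that is flat at the origin. The powers of
    [t^-1] are those produced by differentiating it, so the linear span of the family is closed
    under derivatives. *)
Definition flat k t : R := if 0 < t then t^-1 ^+ k * expR (- t^-1) else 0.

Lemma flat_ge0 k t : 0 <= flat k t.
Proof.
by rewrite /flat; case: ifP => // t0; rewrite mulr_ge0 ?expR_ge0 ?exprn_ge0 ?invr_ge0 ?ltW.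
Qed.

Lemma flat0_gt0 t : 0 < t -> 0 < flat 0 t.
Proof. by rewrite /flat => ->; rewrite expr0 mul1r expR_gt0. Qed.

Lemma flat_le0 k t : t <= 0 -> flat k t = 0.
Proof. by rewrite /flat => t0; rewrite ltNge t0. Qed.

(** The exponential of [t^-1] dominates its Taylor term of degree [k.+2]. Keeping two powers of [t]
    makes the difference quotient at the origin tend to zero. *)
Lemma flat_bound k t : `|flat k t| <= (k.+2)`!%:R * t ^+ 2.
Proof.
rewrite ger0_norm ?flat_ge0 // /flat; case: ifP => t0; last first.
  by rewrite mulr_ge0 ?sqr_ge0.
have := @expR_ge1Dxn R (t^-1) k.+1; rewrite invr_ge0 (ltW t0) => /(_ isT) H.
rewrite expRN ler_pdivrMr ?expR_gt0 //.
have -> : t^-1 ^+ k = t^-1 ^+ k.+2 * t ^+ 2.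
  by rewrite -addn2 exprD -mulrA -exprMn mulVf ?gt_eqF // expr1n mulr1.
rewrite [leRHS]mulrAC ler_pM2r ?exprn_gt0 // -ler_pdivrMl ?ltr0n ?fact_gt0 // mulrC.
by apply: le_trans H; rewrite lerDr.
Qed.

Lemma is_derive_flat k t :
  is_derive t 1 (flat k) (flat k.+2 t - k%:R * flat k.+1 t).
Proof.
have [t0|t0|->] := ltgtP t 0.
- rewrite !flat_le0 ?(ltW t0) // mulr0 subr0.
  apply: (@near_eq_is_derive _ _ _ (cst (0:R))).
  near=> s; rewrite flat_le0 //; apply: ltW; near: s; exact: lt_nbhsl.
- pose V := (fun s : R => s^-1).
  have dV : is_derive t 1 V (- t ^- 2).
    by apply: is_derive_eq (@is_deriveV R id t 1 1 (lt0r_neq0 t0) _) _; rewrite [_ *: _]mulr1.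
  have dE := is_derive1_comp (is_derive_expR _) (is_deriveN dV).
  have dM := is_deriveM (is_deriveX k dV) dE.
  have gE : \forall s \near t, (V ^+ k * (expR \o - V)) s = flat k s.
    near=> s; rewrite /flat ifT; last by near: s; exact: lt_nbhsr.
    by rewrite -[LHS]/((V ^+ k) s * expR (- s^-1)) exprfctE.
  apply: near_eq_is_derive gE (is_derive_eq dM _); rewrite /= exprfctE.
  have scE (a b : R) : a *: b = a * b by [].
  rewrite /flat t0 !scE {scE} -[(- V) t]/(- t^-1) -[V t]/(t^-1).
  rewrite -exprVn expr2; set y := t^-1.
  case: k {dM} => [|k] /=; first by rewrite !expr0; ring.
  by rewrite !exprS; ring.
- rewrite !flat_le0 // mulr0 subr0.
  have lim : h^-1 *: ((flat k \o shift 0) (h *: (1:R)) - flat k 0) @[h --> (0:R)^'] --> (0:R).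
    apply/cvgr0Pnorm_le => e e0.
    have C0 : 0 < (k.+2)`!%:R :> R by rewrite ltr0n fact_gt0.
    near=> h; have h0 : h != 0 by near: h; exact: nbhs_dnbhs_neq.
    rewrite /= addr0 [h *: 1]mulr1 [flat k 0]flat_le0 // subr0 normrM normfV.
    rewrite ler_pdivrMl ?normr_gt0 // (le_trans (flat_bound _ _)) //.
    rewrite -[h ^+ 2]real_normK ?num_real // expr2 mulrCA ler_pM2l ?normr_gt0 //.
    rewrite -ler_pdivlMl // mulrC; near: h.
    by apply: dnbhs0_le; rewrite divr_gt0.
  by apply: DeriveDef; [apply/cvg_ex; eexists; exact: lim | exact: (cvg_lim _ lim)].
Unshelve. all: by end_near. Qed.

End Flat.

(** * Smooth functions on open sets *)

Section SmoothOpen.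
Context {R : realType} {m : nat}.
Local Notation V := 'rV[R]_m.+1.
Implicit Types (f g F : V -> R) (x : V) (U W : set V).

Lemma cvg_row (T : Type) (P : set_system T) {FP : Filter P} (Y : 'I_m.+1 -> T -> R) (y : V) :
  (forall k, Y k t @[t --> P] --> y ord0 k) -> (\row_k Y k t) @[t --> P] --> y.
Proof.
move=> cY; apply/cvg_ballP => e e0.
have : \forall t \near P, forall k, `|y ord0 k - Y k t| < e.
  apply: (@filter_forall T _ (fun k t => `|y ord0 k - Y k t| < e) P _) => k.
  by have /cvgrPdist_lt := cY k; apply.
by apply: filterS => t H; apply: ball_rV => // k; rewrite mxE.
Qed.

Lemma smooth_openS F U W : W `<=` U -> smooth_open U F -> smooth_open W F.
Proof. by move=> WU sF s x /WU; apply: sF. Qed.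

Lemma smooth_open_continuous F U x : smooth_open U F -> U x -> {for x, continuous F}.
Proof. by move=> sF Ux; have [] := sF [::] x Ux. Qed.

Lemma smooth_open_derivable F U x i : smooth_open U F -> U x -> derivable F x (e_ i).
Proof. by move=> sF Ux; have [_] := sF [::] x Ux; apply. Qed.

Lemma smooth_open_derive F U i : smooth_open U F -> smooth_open U ('D_(e_ i) F).
Proof.
move=> sF s x Ux; have := sF (rcons s i) x Ux.
by rewrite /iter_partial foldr_rcons.
Qed.

Lemma smooth_open_derive_mixed F U x i j : open U -> U x -> smooth_open U F ->
  'D_(e_ i) ('D_(e_ j) F) x = 'D_(e_ j) ('D_(e_ i) F) x.
Proof.
move=> oU Ux sF.
have sD k := smooth_open_derive k sF.
have sDD k l := smooth_open_derive l (sD k).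
apply: (derive_mixedC oU Ux).
- move=> z Uz; split; first exact: (smooth_open_derivable sF Uz).
  split; first exact: (smooth_open_derivable sF Uz).
  split; first exact: (smooth_open_derivable (sD i) Uz).
  exact: (smooth_open_derivable (sD j) Uz).
- exact: (smooth_open_continuous (sDD j i) Ux).
- exact: (smooth_open_continuous (sDD i j) Ux).
Qed.

(* Every function in this class has partial derivatives in the class, which makes
   the whole class smooth. *)
Inductive smooth_alg U : (V -> R) -> Prop :=
| smooth_alg_base f : smooth_open U f -> smooth_alg U f
| smooth_alg_cst (a : R) : smooth_alg U (cst a)
| smooth_alg_coord i : smooth_alg U (fun x => x ord0 i)
| smooth_alg_add f g : smooth_alg U f -> smooth_alg U g -> smooth_alg U (f + g)
| smooth_alg_mul f g : smooth_alg U f -> smooth_alg U g -> smooth_alg U (f * g)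
| smooth_alg_exp f : smooth_alg U f -> smooth_alg U (expR \o f)
| smooth_alg_flat k f : smooth_alg U f -> smooth_alg U (flat k \o f)
| smooth_alg_comp W F (Y : 'I_m.+1 -> V -> R) : open W -> smooth_open W F ->
    (forall k, smooth_alg U (Y k)) -> (forall x, U x -> W (\row_k Y k x)) ->
    smooth_alg U (F \o (fun x => \row_k Y k x)).

Lemma is_derive_coord x i j : is_derive x (e_ i : V) (fun y : V => y ord0 j) (j == i)%:R.
Proof.
apply: is_derive_of_line.
have -> : (fun s : R => (x + s *: (e_ i : V)) ord0 j) = cst (x ord0 j) + (j == i)%:R \*: id.
  by apply/funext => s; rewrite !mxE eqxx /= mulrC.
apply: is_derive_eq (is_deriveD (is_derive_cst (x ord0 j) (0 : R) (1 : R))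
  (is_deriveZ ((j == i)%:R) (is_derive_id (0 : R) (1 : R)))) _.
by rewrite add0r [_ *: _]mulr1.
Qed.

Lemma is_derive_comp_row W F (Y : 'I_m.+1 -> V -> R) (dY : 'I_m.+1 -> R) x (v : V) :
  open W -> W (\row_k Y k x) -> smooth_open W F ->
  (forall k, is_derive x v (Y k) (dY k)) ->
  is_derive x v (F \o (fun x => \row_k Y k x))
    (\sum_k dY k * 'D_(e_ k) F (\row_k Y k x)).
Proof.
move=> oW Wy sF dYk; apply: is_derive_of_line.
pose y (t : R) : V := \row_k Y k (x + t *: v).
have y0 : y 0 = \row_k Y k x by rewrite /y scale0r addr0.
rewrite -y0; apply: (is_derive_curve (U := W) (y := y) oW); rewrite ?y0 //.
- by move=> z i; apply: smooth_open_derivable.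
- by move=> i; apply: smooth_open_continuous Wy; apply: smooth_open_derive.
- move=> k; have [dk <-] := dYk k.
  have -> : (fun t => y t ord0 k) = (fun t => Y k (x + t *: v)).
    by apply/funext => t; rewrite mxE.
  by have := @is_derive_line R V (Y k) x v 0; rewrite scale0r addr0; apply.
Qed.

Lemma smooth_alg_sum U (I : Type) (r : seq I) (h : I -> V -> R) :
  (forall i, smooth_alg U (h i)) -> smooth_alg U (\sum_(i <- r) h i).
Proof.
move=> H; elim/big_rec : _ => [|i f _ Hf]; first exact: smooth_alg_cst.
exact: smooth_alg_add.
Qed.

(** Induction on the construction of [f]. The derivative is returned as a member of the class, so
    that the step can be iterated; everything is claimed on [U] only, since the base functions are
    arbitrary outside it. *)
Lemma smooth_alg_step U f : open U -> smooth_alg U f ->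
  (forall x, U x -> {for x, continuous f}) /\
  forall i, exists2 g, smooth_alg U g & forall x, U x -> is_derive x (e_ i) f (g x).
Proof.
move=> oU; elim=> {f} [f sf|a|j|f g _ [cf df] _ [cg dg]|f g fA [cf df] gA [cg dg]|
  f fA [cf df]|k f fA [cf df]|W F Y oW sF YA H YW].
- split=> [x Ux|i]; first exact: smooth_open_continuous sf Ux.
  exists ('D_(e_ i) f); first exact/smooth_alg_base/smooth_open_derive.
  by move=> x Ux; apply: DeriveDef => //; exact: smooth_open_derivable sf Ux.
- split=> [x _|i]; first exact: cst_continuous.
  by exists (cst 0); [exact: smooth_alg_cst | move=> x _; exact: is_derive_cst].
- split=> [x _|i]; first exact: matrix_normedtype.coord_continuous.
  exists (cst (j == i)%:R); [exact: smooth_alg_cst | move=> x _; exact: is_derive_coord].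
- split=> [x Ux|i]; first exact: cvgD (cf x Ux) (cg x Ux).
  have [f' f'A f'E] := df i; have [g' g'A g'E] := dg i.
  exists (f' + g'); first exact: smooth_alg_add.
  by move=> x Ux; exact: is_deriveD (f'E x Ux) (g'E x Ux).
- split=> [x Ux|i]; first exact: cvgM (cf x Ux) (cg x Ux).
  have [f' f'A f'E] := df i; have [g' g'A g'E] := dg i.
  exists (f * g' + g * f'); first by apply: smooth_alg_add; apply: smooth_alg_mul.
  by move=> x Ux; exact: is_deriveM (f'E x Ux) (g'E x Ux).
- split=> [x Ux|i].
    apply: continuous_comp; [exact: cf | exact: continuous_expR].
  have [f' f'A f'E] := df i.
  exists ((expR \o f) * f'); first by apply: smooth_alg_mul => //; apply: smooth_alg_exp.
  move=> x Ux; have [fd fE] := f'E x Ux.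
  by apply: is_derive_eq (is_derive_comp1 fd (is_derive_expR (f x))) _; rewrite fE.
- split=> [x Ux|i].
    apply: continuous_comp; first exact: cf.
    by apply: differentiable_continuous; apply/derivable1_diffP; case: (is_derive_flat k (f x)).
  have [f' f'A f'E] := df i.
  exists ((flat k.+2 \o f + cst (- k%:R) * (flat k.+1 \o f)) * f').
    apply: smooth_alg_mul => //; apply: smooth_alg_add; first exact: smooth_alg_flat.
    by apply: smooth_alg_mul; [exact: smooth_alg_cst | exact: smooth_alg_flat].
  move=> x Ux; have [fd fE] := f'E x Ux.
  by apply: is_derive_eq (is_derive_comp1 fd (is_derive_flat k (f x))) _; rewrite fE -mulNr.
- split=> [x Ux|i].
    apply: (@continuous_comp _ _ _ (fun x => \row_k Y k x) F); last first.
      exact: smooth_open_continuous sF (YW _ Ux).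
    apply: (cvg_row (FP := nbhs_filter x)) => k; rewrite mxE.
    by have [cY _] := H k; exact: cY.
  have /choice[Y' Y'P] : forall k, exists Y',
      smooth_alg U Y' /\ forall x, U x -> is_derive x (e_ i) (Y k) (Y' x).
    by move=> k; have [_ /(_ i)[g gA gE]] := H k; exists g.
  exists (\sum_k Y' k * ('D_(e_ k) F \o (fun x => \row_k Y k x))).
    apply: smooth_alg_sum => k; apply: smooth_alg_mul; first by have [] := Y'P k.
    by apply: smooth_alg_comp oW _ YA YW; exact: smooth_open_derive.
  move=> x Ux; rewrite fct_sumE.
  by apply: is_derive_comp_row oW (YW _ Ux) sF _ => k; have [_] := Y'P k; apply.
Qed.

Lemma smooth_alg_smooth_open U f : open U -> smooth_alg U f -> smooth_open U f.
Proof.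
move=> oU fA s.
(* An iterated derivative is matched with a member of the class on [U]. As [U] is open, the match
   holds near each of its points and survives one more differentiation. *)
have [g gA fg] : exists2 g, smooth_alg U g & forall x, U x -> iter_partial s f x = g x.
  elim: s => [|i s [g gA gE]]; first by exists f.
  have [_ /(_ i)[g' g'A g'E]] := smooth_alg_step oU gA.
  exists g' => // x Ux; have [_ <-] := g'E x Ux.
  apply: near_eq_derive; apply: filterS (open_nbhs_nbhs (conj oU Ux)).
  exact: gE.
move=> x Ux; have [gc gd] := smooth_alg_step oU gA.
have near_fg : \forall y \near x, g y = iter_partial s f y.
  by apply: filterS (open_nbhs_nbhs (conj oU Ux)) => y /fg.
split.
  rewrite /prop_for /continuous_at fg //.
  by apply: cvg_trans (gc x Ux); apply: (near_eq_cvg near_fg).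
move=> i; have [g' _ /(_ x Ux)[dg _]] := gd i.
exact: derivable_ext_near near_fg dg.
Qed.

End SmoothOpen.

(** * Smooth functions on arbitrary sets, through local extensions *)

Section SmoothOn.
Context {R : realType} {m : nat}.
Local Notation V := 'rV[R]_m.+1.
Implicit Types (f g F : V -> R) (x y : V) (A B U W : set V) (i j : 'I_m.+1).

(** The shape of chart images. Near a point of such a set, every small increment that stays in the
    half-space stays in the set, so [pderiv] sees only values on it. *)
Definition half_open A := exists2 O, open O & A = O `&` half_space.

Lemma smooth_on_congr A f g : (forall x, A x -> f x = g x) ->
  smooth_on A f -> smooth_on A g.
Proof.
move=> fg sf x Ax; have [U [F [oU Ux sF FE]]] := sf x Ax.
by exists U, F; split => // y Ay Uy; rewrite FE // fg.
Qed.

Lemma smooth_onS A B f : B `<=` A -> smooth_on A f -> smooth_on B f.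
Proof.
move=> sBA sf x /sBA Ax; have [U [F [oU Ux sF FE]]] := sf x Ax.
by exists U, F; split => // y /sBA; exact: FE.
Qed.

Lemma smooth_on_local A f :
  (forall x, A x -> exists U, [/\ open U, U x & smooth_on (A `&` U) f]) -> smooth_on A f.
Proof.
move=> H x Ax; have [U [oU Ux sf]] := H x Ax.
have [W [F [oW Wx sF FE]]] := sf x (conj Ax Ux).
exists (U `&` W), F; split; [exact: openI| by []| |].
  by apply: smooth_openS sF; exact: subIsetr.
by move=> y Ay [Uy Wy]; exact: FE.
Qed.

Lemma smooth_on_alg A f :
  (forall x, A x -> exists U F, [/\ open U, U x, smooth_alg U F &
     forall y, A y -> U y -> F y = f y]) -> smooth_on A f.
Proof.
move=> H x Ax; have [U [F [oU Ux sF FE]]] := H x Ax.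
by exists U, F; split => //; exact: smooth_alg_smooth_open.
Qed.

Lemma smooth_on_cst A (a : R) : smooth_on A (fun=> a).
Proof.
apply: smooth_on_alg => x _; exists setT, (cst a); split => //; first exact: openT.
exact: smooth_alg_cst.
Qed.

Lemma smooth_on_coord A i : smooth_on A (fun x => x ord0 i).
Proof.
apply: smooth_on_alg => x _; exists setT, (fun x : V => x ord0 i).
by split => //; [exact: openT | exact: smooth_alg_coord].
Qed.

(** The extensions of [f] and [g] live on different neighbourhoods and are combined on the
    intersection. Unary operations are the case where [op] ignores an argument. *)
Lemma smooth_on_op2 (op : R -> R -> R) A f g :
  (forall U F G, smooth_alg U F -> smooth_alg U G -> smooth_alg U (fun x => op (F x) (G x))) ->
  smooth_on A f -> smooth_on A g -> smooth_on A (fun x => op (f x) (g x)).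
Proof.
move=> opA sf sg; apply: smooth_on_alg => x Ax.
have [U [F [oU Ux sF FE]]] := sf x Ax; have [W [G [oW Wx sG GE]]] := sg x Ax.
exists (U `&` W), (fun x => op (F x) (G x)); split; [exact: openI| by []| |].
  by apply: opA; apply: smooth_alg_base;
    [apply: smooth_openS sF; exact: subIsetl|apply: smooth_openS sG; exact: subIsetr].
by move=> y Ay [Uy Wy]; rewrite FE // GE.
Qed.

Lemma smooth_onD A f g : smooth_on A f -> smooth_on A g -> smooth_on A (fun x => f x + g x).
Proof. by apply: smooth_on_op2 => U F G; exact: smooth_alg_add. Qed.

Lemma smooth_onM A f g : smooth_on A f -> smooth_on A g -> smooth_on A (fun x => f x * g x).
Proof. by apply: smooth_on_op2 => U F G; exact: smooth_alg_mul. Qed.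

Lemma smooth_onN A f : smooth_on A f -> smooth_on A (fun x => - f x).
Proof.
move=> sf; apply: (smooth_on_congr (f := fun x => -1 * f x)) => [x _|].
  by rewrite mulN1r.
by apply: smooth_onM => //; exact: smooth_on_cst.
Qed.

Lemma smooth_on_sum A (I : Type) (r : seq I) (P : pred I) (h : I -> V -> R) :
  (forall k, smooth_on A (h k)) -> smooth_on A (fun x => \sum_(k <- r | P k) h k x).
Proof.
move=> sh; elim: r => [|i r IH].
  by apply: smooth_on_congr (@smooth_on_cst A 0) => x _; rewrite big_nil.
case Pi : (P i); last by apply: smooth_on_congr IH => x _; rewrite big_cons Pi.
by apply: smooth_on_congr (smooth_onD (sh i) IH) => x _; rewrite big_cons Pi.
Qed.

Lemma smooth_on_exp A f : smooth_on A f -> smooth_on A (fun x => expR (f x)).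
Proof.
move=> sf; apply: (@smooth_on_op2 (fun a _ => expR a) A f f) => // U F G sF _.
exact: smooth_alg_exp.
Qed.

Lemma smooth_on_flat A k f : smooth_on A f -> smooth_on A (fun x => flat k (f x)).
Proof.
move=> sf; apply: (@smooth_on_op2 (fun a _ => flat k a) A f f) => // U F G sF _.
exact: smooth_alg_flat.
Qed.

Lemma smooth_on_ext_family A (Y : 'I_m.+1 -> V -> R) x :
  (forall k, smooth_on A (Y k)) -> A x ->
  exists U (YY : 'I_m.+1 -> V -> R), [/\ open U, U x, forall k, smooth_open U (YY k) &
    forall k y, A y -> U y -> YY k y = Y k y].
Proof.
move=> sY Ax.
have /choice[UF UFP] : forall k, exists UF : set V * (V -> R), [/\ open UF.1, UF.1 x,
    smooth_open UF.1 UF.2 & forall y, A y -> UF.1 y -> UF.2 y = Y k y].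
  by move=> k; have [U [F H]] := sY k x Ax; exists (U, F).
exists (\big[setI/setT]_k (UF k).1), (fun k => (UF k).2).
have sub k : \big[setI/setT]_k (UF k).1 `<=` (UF k).1.
  by rewrite (bigD1 k) //=; exact: subIsetl.
split.
- elim/big_ind : _ => [|B C|k _]; [exact: openT | exact: openI | by have [] := UFP k].
- by elim/big_ind : _ => // k _; have [] := UFP k.
- by move=> k; apply: smooth_openS (sub k) _; have [] := UFP k.
- move=> k y Ay /(sub k) Uy; have [_ _ _ E] := UFP k; exact: E.
Qed.

(** The extension [Z] of [Y] may leave [B] at points outside [A]. It only has to land in the open
    set [W] where [f] is extended, and continuity of [Z] makes that an open condition. *)
Lemma smooth_on_comp A B f (Y : V -> V) :
  (forall x, A x -> B (Y x)) -> (forall k, smooth_on A (fun x => Y x ord0 k)) ->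
  smooth_on B f -> smooth_on A (fun x => f (Y x)).
Proof.
move=> YAB sY sf; apply: smooth_on_alg => x Ax.
have [U [YY [oU Ux sYY YYE]]] := smooth_on_ext_family sY Ax.
have [W [F [oW Wy sF FE]]] := sf (Y x) (YAB x Ax).
pose Z z : V := \row_k YY k z.
have ZE y : A y -> U y -> Z y = Y y.
  by move=> Ay Uy; apply/rowP => k; rewrite mxE YYE.
have cZ y : U y -> {for y, continuous Z}.
  move=> Uy; apply: (cvg_row (FP := nbhs_filter y)) => k; rewrite mxE.
  exact: smooth_open_continuous (sYY k) Uy.
exists (U `&` Z @^-1` W), (F \o Z); split.
- rewrite openE => y [Uy Wy']; rewrite /interior; apply: filterI.
    exact: open_nbhs_nbhs.
  by apply: cZ Uy _ _; exact: open_nbhs_nbhs.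
- by split => //=; rewrite /= ZE.
- apply: smooth_alg_comp oW sF _ _; last by move=> y [].
  move=> k; apply/smooth_alg_base/(smooth_openS _ (sYY k)); exact: subIsetl.
- by move=> y Ay [Uy Wy'] /=; move: Wy'; rewrite /= ZE // => Wy'; rewrite FE // ; apply: YAB.
Qed.

Lemma smooth_on_cvg A f x : smooth_on A f -> A x -> f y @[y --> within A (nbhs x)] --> f x.
Proof.
move=> sf Ax; have [U [F [oU Ux sF FE]]] := sf x Ax.
rewrite -(FE x Ax Ux).
apply: (@cvg_trans _ (F y @[y --> within A (nbhs x)])); last first.
  apply: cvg_trans (smooth_open_continuous sF Ux); apply: cvg_app; exact: cvg_within.
apply: near_eq_cvg; apply: filterS (open_nbhs_nbhs (conj oU Ux)).
by move=> y Uy Ay; exact: FE.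
Qed.

Lemma near_line U x (v : V) : open U -> U x -> \forall h \near (0 : R), U (x + h *: v).
Proof.
move=> oU Ux.
have c : x + h *: v @[h --> (0:R)] --> x + 0 *: v.
  by apply: cvgD; [exact: cvg_cst | apply: cvgZr_tmp; exact: cvg_id].
by apply: c; rewrite scale0r addr0; exact: open_nbhs_nbhs.
Qed.

End SmoothOn.

(** * One-sided partial derivatives up to the boundary *)

Section PartialDerivatives.
Context {R : realType} {m : nat}.
Local Notation V := 'rV[R]_m.+1.
Implicit Types (f g F : V -> R) (x y : V) (A B U W : set V) (i j : 'I_m.+1).

Lemma half_space_ray x i (h : R) : half_space x -> 0 <= h -> half_space (x + h *: e_ i).
Proof.
rewrite /half_space /= => x0 h0; rewrite !mxE eqxx /=.
by rewrite addr_ge0 // mulr_ge0.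
Qed.

Lemma half_open_half_space A x : half_open A -> A x -> half_space x.
Proof. by move=> [Om _ ->] []. Qed.

Lemma half_open_near A U x i : half_open A -> A x -> open U -> U x ->
  \forall h \near (0 : R), half_space (x + h *: e_ i) ->
    A (x + h *: e_ i) /\ U (x + h *: e_ i).
Proof.
move=> [Om oOm ->] [Ox _] oU Ux.
by apply: filterS2 (near_line (e_ i) oOm Ox) (near_line (e_ i) oU Ux) => h.
Qed.

Definition quotient i f x (h : R) : R := h^-1 * (f (x + h *: e_ i) - f x).

Lemma quotient_cvg A U i f F x : half_open A -> A x -> open U -> U x ->
  derivable F x (e_ i) -> (forall y, A y -> U y -> F y = f y) ->
  quotient i f x h @[h --> within [set h | half_space (x + h *: e_ i)] (0 : R)^']
    --> 'D_(e_ i) F x.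
Proof.
move=> hA Ax oU Ux dF FE.
have : quotient i F x h @[h --> (0 : R)^'] --> 'D_(e_ i) F x.
  have -> : quotient i F x =
      (fun h : R => h^-1 *: ((F \o shift x) (h *: e_ i) - F x)).
    by apply/funext => h; rewrite /quotient /= [h *: e_ i + x]addrC.
  exact: dF.
move=> cF; apply: cvg_trans (cvg_trans (cvg_app _ (cvg_within _)) cF).
apply: near_eq_cvg; rewrite near_withinE; apply: cvg_within.
apply: filterS (half_open_near i hA Ax oU Ux).
move=> h H xh; rewrite /quotient (FE x Ax Ux); congr (_ * (_ - _)).
by have [Ay Uy] := H xh; rewrite FE.
Qed.

(** Positive increments never leave the half-space, in any coordinate direction. So the filter
    defining [pderiv] is proper, its limits are unique, and right-hand quotients suffice to
    determine signs. *)
Lemma at_right_le_half x i : half_space x ->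
  within [set h | half_space (x + h *: e_ i)] (0 : R)^' `<=` at_right (0 : R).
Proof.
move=> hx P NP; change (nbhs (0 : R) (fun h => h != 0 -> half_space (x + h *: e_ i) -> P h)) in NP.
change (nbhs (0 : R) (fun h => 0 < h -> P h)).
apply: filterS NP => h H h0; apply: H; first by rewrite gt_eqF.
by apply: half_space_ray => //; exact: ltW.
Qed.

Global Instance half_quotient_filter x i : half_space x ->
  ProperFilter (within [set h | half_space (x + h *: e_ i)] (0 : R)^').
Proof.
move=> hx; apply: Build_ProperFilter_ex => P /(at_right_le_half hx) PP.
exact: (@filter_ex _ (at_right (0:R)) _ P PP).
Qed.

Lemma pderivE A U i f F x : half_open A -> A x -> open U -> U x ->
  derivable F x (e_ i) -> (forall y, A y -> U y -> F y = f y) ->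
  pderiv i f x = 'D_(e_ i) F x.
Proof.
move=> hA Ax oU Ux dF FE.
have PF := half_quotient_filter i (half_open_half_space hA Ax).
exact: (cvg_lim _ (quotient_cvg hA Ax oU Ux dF FE)).
Qed.

Lemma pderiv_right A i f x : half_open A -> A x -> smooth_on A f ->
  quotient i f x h @[h --> at_right (0 : R)] --> pderiv i f x.
Proof.
move=> hA Ax sf; have [U [F [oU Ux sF FE]]] := sf x Ax.
have dF := smooth_open_derivable sF Ux (i := i).
rewrite (pderivE hA Ax oU Ux dF FE).
apply: cvg_trans (quotient_cvg hA Ax oU Ux dF FE); apply: cvg_app.
exact: at_right_le_half (half_open_half_space hA Ax).
Qed.

Lemma open_half_space_interior : open [set y : V | 0 < y ord0 ord0].
Proof.
apply: (open_comp (f := fun y : V => y ord0 ord0) (D := [set r | 0 < r])).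
  by move=> ? _; exact: matrix_normedtype.coord_continuous.
exact: open_gt.
Qed.

Lemma pderiv_left A i f x : half_open A -> A x -> smooth_on A f -> 0 < x ord0 ord0 ->
  quotient i f x h @[h --> at_left (0 : R)] --> pderiv i f x.
Proof.
move=> hA Ax sf x0; have [U [F [oU Ux sF FE]]] := sf x Ax.
have dF := smooth_open_derivable sF Ux (i := i).
rewrite (pderivE hA Ax oU Ux dF FE).
apply: cvg_trans (quotient_cvg hA Ax oU Ux dF FE); apply: cvg_app.
move=> P NP; change (nbhs (0 : R) (fun h => h != 0 -> half_space (x + h *: e_ i) -> P h)) in NP.
change (nbhs (0 : R) (fun h => h < 0 -> P h)).
apply: filterS2 (near_line (e_ i) open_half_space_interior x0) NP => h hx H h0; apply: H; first by rewrite lt_eqF.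
exact: ltW.
Qed.

(** One extension serves at all points of [A] near [x], so its partial derivatives extend those of
    [f]; this gives access to second derivatives. *)
Lemma smooth_on_jet A f x : half_open A -> A x -> smooth_on A f ->
  exists U F, [/\ open U, U x, smooth_open U F, forall y, A y -> U y -> F y = f y &
    forall y i, A y -> U y -> 'D_(e_ i) F y = pderiv i f y].
Proof.
move=> hA Ax sf; have [U [F [oU Ux sF FE]]] := sf x Ax; exists U, F; split => //.
by move=> y i Ay Uy; rewrite (pderivE hA Ay oU Uy (smooth_open_derivable sF Uy) FE).
Qed.

Lemma smooth_on_pderiv A f i : half_open A -> smooth_on A f -> smooth_on A (pderiv i f).
Proof.
move=> hA sf x Ax; have [U [F [oU Ux sF FE dFE]]] := smooth_on_jet hA Ax sf.
by exists U, ('D_(e_ i) F); split => //; [exact: smooth_open_derive | move=> y; exact: dFE].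
Qed.

Lemma pderiv_congr A f g i x : half_open A -> A x -> (forall y, A y -> f y = g y) ->
  smooth_on A f -> pderiv i f x = pderiv i g x.
Proof.
move=> hA Ax fg sf; have [U [F [oU Ux sF FE dFE]]] := smooth_on_jet hA Ax sf.
rewrite -dFE //; apply/esym/(pderivE hA Ax oU Ux (smooth_open_derivable sF Ux)).
by move=> y Ay Uy; rewrite FE // fg.
Qed.

Lemma pderivC A f i j x : half_open A -> A x -> smooth_on A f ->
  pderiv i (pderiv j f) x = pderiv j (pderiv i f) x.
Proof.
move=> hA Ax sf; have [U [F [oU Ux sF FE dFE]]] := smooth_on_jet hA Ax sf.
have D k l : pderiv k (pderiv l f) x = 'D_(e_ k) ('D_(e_ l) F) x.
  apply: (pderivE hA Ax oU Ux); last by move=> y; exact: dFE.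
  exact: (smooth_open_derivable (smooth_open_derive l sF) Ux).
rewrite (D i j) (D j i); exact: (smooth_open_derive_mixed i j oU Ux sF).
Qed.

Lemma pderiv_op2 (op : R -> R -> R) A f g i x (l : R) : half_open A -> A x ->
  smooth_on A f -> smooth_on A g ->
  (forall F G, is_derive x (e_ i) F (pderiv i f x) -> is_derive x (e_ i) G (pderiv i g x) ->
     F x = f x -> G x = g x -> is_derive x (e_ i) (fun y => op (F y) (G y)) l) ->
  pderiv i (fun y => op (f y) (g y)) x = l.
Proof.
move=> hA Ax sf sg H.
have [U [F [oU Ux sF FE dFE]]] := smooth_on_jet hA Ax sf.
have [W [G [oW Wx sG GE dGE]]] := smooth_on_jet hA Ax sg.
have [|||| d <-] := H F G.
- by rewrite -dFE //; apply: DeriveDef => //; exact: smooth_open_derivable sF Ux.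
- by rewrite -dGE //; apply: DeriveDef => //; exact: smooth_open_derivable sG Wx.
- exact: FE.
- exact: GE.
apply: (pderivE (U := U `&` W) hA Ax _ _ d); [exact: openI | by [] |].
by move=> y Ay [Uy Wy]; rewrite FE // GE.
Qed.

Lemma pderivD A f g i x : half_open A -> A x -> smooth_on A f -> smooth_on A g ->
  pderiv i (fun y => f y + g y) x = pderiv i f x + pderiv i g x.
Proof.
by move=> hA Ax sf sg; apply: (pderiv_op2 hA Ax sf sg) => F G dF dG _ _; exact: is_deriveD.
Qed.

Lemma pderivM A f g i x : half_open A -> A x -> smooth_on A f -> smooth_on A g ->
  pderiv i (fun y => f y * g y) x = pderiv i f x * g x + f x * pderiv i g x.
Proof.
move=> hA Ax sf sg; apply: (pderiv_op2 hA Ax sf sg) => F G dF dG <- <-.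
by apply: is_derive_eq (is_deriveM dF dG) _; rewrite addrC; congr (_ + _); rewrite mulrC.
Qed.

Lemma pderiv_exp A f i x : half_open A -> A x -> smooth_on A f ->
  pderiv i (fun y => expR (f y)) x = expR (f x) * pderiv i f x.
Proof.
move=> hA Ax sf; apply: (@pderiv_op2 (fun a _ => expR a) A f f) => // F _ [dF <-] _ <- _.
exact: is_derive_comp1 dF (is_derive_expR (F x)).
Qed.

Lemma pderiv_cst A (a : R) i x : half_open A -> A x -> pderiv i (fun=> a) x = 0.
Proof.
move=> hA Ax; have [d <-] := is_derive_cst a x (e_ i : V).
by apply: (pderivE (U := setT) hA Ax) => //; exact: openT.
Qed.

Lemma pderivZ A f (a : R) i x : half_open A -> A x -> smooth_on A f ->
  pderiv i (fun y => a * f y) x = a * pderiv i f x.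
Proof.
move=> hA Ax sf; rewrite (pderivM _ hA Ax (@smooth_on_cst _ _ A a) sf) (pderiv_cst _ _ hA Ax).
by rewrite mul0r add0r.
Qed.

Lemma pderiv_coord A i j x : half_open A -> A x ->
  pderiv i (fun y => y ord0 j) x = (j == i)%:R.
Proof.
move=> hA Ax; have [d <-] := is_derive_coord x i j.
by apply: (pderivE (U := setT) hA Ax) => //; exact: openT.
Qed.

Lemma pderiv_sum A (I : Type) (r : seq I) (P : pred I) (h : I -> V -> R) i x :
  half_open A -> A x -> (forall k, smooth_on A (h k)) ->
  pderiv i (fun y => \sum_(k <- r | P k) h k y) x = \sum_(k <- r | P k) pderiv i (h k) x.
Proof.
move=> hA Ax sh; elim: r => [|k r IH].
  have -> : (fun y => \sum_(k <- [::] | P k) h k y) = (fun=> 0).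
    by apply/funext => y; rewrite big_nil.
  by rewrite big_nil (pderiv_cst 0 i hA Ax).
have -> : (fun y => \sum_(k <- k :: r | P k) h k y) =
    (fun y => (if P k then h k y else 0) + \sum_(k <- r | P k) h k y).
  by apply/funext => y; rewrite big_cons; case: ifP => // _; rewrite add0r.
have sr : smooth_on A (fun y => \sum_(k <- r | P k) h k y) by exact: smooth_on_sum.
rewrite big_cons; case: (P k).
  by rewrite (pderivD i hA Ax (sh k) sr) IH.
by rewrite (pderivD i hA Ax (@smooth_on_cst _ _ A 0) sr) (pderiv_cst 0 i hA Ax) add0r IH.
Qed.

Lemma pderiv_comp A B f (Y : V -> V) i x : half_open A -> half_open B -> A x ->
  (forall y, A y -> B (Y y)) -> (forall k, smooth_on A (fun y => Y y ord0 k)) ->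
  smooth_on B f ->
  pderiv i (fun y => f (Y y)) x =
  \sum_k pderiv i (fun y => Y y ord0 k) x * pderiv k f (Y x).
Proof.
move=> hA hB Ax YAB sY sf.
have [U [YY [oU Ux sYY YYE]]] := smooth_on_ext_family sY Ax.
have [W [F [oW Wy sF FE dFE]]] := smooth_on_jet hB (YAB x Ax) sf.
pose Z z : V := \row_k YY k z.
have ZE y : A y -> U y -> Z y = Y y.
  by move=> Ay Uy; apply/rowP => k; rewrite mxE YYE.
have dY k : is_derive x (e_ i) (YY k) (pderiv i (fun y => Y y ord0 k) x).
  rewrite (pderivE hA Ax oU Ux (smooth_open_derivable (sYY k) Ux)); last exact: YYE.
  by apply: DeriveDef => //; exact: smooth_open_derivable (sYY k) Ux.
have WZ : W (\row_k YY k x) by rewrite -/(Z x) ZE.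
have [d dE] := is_derive_comp_row oW WZ sF dY.
have cZ y : U y -> {for y, continuous Z}.
  move=> Uy; apply: (cvg_row (FP := nbhs_filter y)) => k; rewrite mxE.
  exact: smooth_open_continuous (sYY k) Uy.
transitivity ('D_(e_ i) (F \o Z) x).
  apply: (pderivE (U := U `&` Z @^-1` W) hA Ax _ _ d).
  - rewrite openE => y [Uy Wy']; rewrite /interior; apply: filterI.
      exact: open_nbhs_nbhs.
    by apply: cZ Uy _ _; exact: open_nbhs_nbhs.
  - by split => //=; rewrite /= ZE.
  - move=> y Ay [Uy Wy']; have WY : W (Y y) by rewrite -ZE.
    by rewrite -[LHS]/(F (Z y)) ZE // FE //; exact: YAB.
apply: etrans dE _; apply: eq_bigr => k _; congr (_ * _).
rewrite -/(Z x) ZE // dFE //; exact: YAB.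
Qed.

Lemma half_open_right A x i : half_open A -> A x ->
  \forall h \near at_right (0 : R), 0 < h /\ A (x + h *: e_ i).
Proof.
move=> hA Ax; have N := half_open_near i hA Ax (@openT _) (I : setT x).
apply: filterS2 (nbhs_right_gt (0 : R)) (cvg_within _ N) => h h0 H; split=> //.
by have [] := H (half_space_ray i (half_open_half_space hA Ax) (ltW h0)).
Qed.

(** A tangential increment keeps the normal coordinate equal to zero, so the difference quotients
    vanish identically. *)
Lemma pderiv_tangential0 A f i x : half_open A -> A x -> smooth_on A f ->
  (forall y, A y -> y ord0 ord0 = 0 -> f y = 0) -> x ord0 ord0 = 0 -> i != ord0 ->
  pderiv i f x = 0.
Proof.
move=> hA Ax sf f0 x0 i0.
have c := pderiv_right hA Ax sf (i := i).
have N : \forall h \near at_right (0 : R), quotient i f x h = 0.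
  apply: filterS (half_open_right i hA Ax) => h [h0 Ay].
  rewrite /quotient !f0 ?subrr ?mulr0 // !mxE x0 eqxx /= eq_sym (negbTE i0).
  by rewrite mulr0 addr0.
apply/eqP; rewrite eq_le; apply/andP; split.
  by apply: (cvgr_to_le c); apply: filterS N => h ->.
by apply: (cvgr_to_ge c); apply: filterS N => h ->.
Qed.

Lemma pderiv_min_ge0 A f x i : half_open A -> A x -> smooth_on A f ->
  (forall y, A y -> f x <= f y) -> 0 <= pderiv i f x.
Proof.
move=> hA Ax sf fx; apply: (cvgr_to_ge (pderiv_right hA Ax sf (i := i))).
apply: filterS (half_open_right i hA Ax) => h [h0 Ay].
by rewrite /quotient mulr_ge0 ?invr_ge0 ?(ltW h0) // subr_ge0 fx.
Qed.

(** At an interior point increments of both signs are admissible, and the left-hand quotients at a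
    minimum are nonpositive. *)
Lemma pderiv_interior_min A f x i : half_open A -> A x -> smooth_on A f ->
  0 < x ord0 ord0 -> (forall y, A y -> f x <= f y) -> pderiv i f x = 0.
Proof.
move=> hA Ax sf x0 fx; apply/eqP; rewrite eq_le (pderiv_min_ge0 i hA Ax sf fx) andbT.
apply: (cvgr_to_le (pderiv_left hA Ax sf x0 (i := i))).
have [Om oOm AE] := hA.
have N := half_open_near i hA Ax (@openT _) (I : setT x).
have P := near_line (e_ i) open_half_space_interior x0.
apply: filterS3 (nbhs_left_lt (0 : R)) (cvg_within _ N) (cvg_within _ P) => h h0 H Hp.
have [Ay _] := H (ltW Hp).
by rewrite /quotient mulr_le0_ge0 ?invr_le0 ?(ltW h0) // subr_ge0 fx.
Qed.

End PartialDerivatives.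

(** * Positive definite matrices and the algebra of Christoffel symbols *)

Section LinearAlgebra.
Context {R : realFieldType}.

Definition posdef n (A : 'M[R]_n) := forall v : 'rV_n, v != 0 -> 0 < (v *m A *m v^T) ord0 ord0.

Lemma posdef_unitmx n (A : 'M[R]_n) : posdef A -> A \in unitmx.
Proof.
move=> pA; rewrite -row_free_unit -kermx_eq0; apply/rowV0P => v /sub_kermxP vA.
apply/eqP; apply: contraT => /pA.
by rewrite vA mul0mx mxE ltxx.
Qed.

(** Padding with a zero normal component embeds the tangential vectors, so the tangential block
    inherits positive definiteness. *)
Lemma mulmx_row_lift n (A : 'M[R]_n.+1) (v : 'rV[R]_n) :
  let w : 'rV_n.+1 := \row_j (if unlift ord0 j is Some a then v ord0 a else 0) in
  w *m A *m w^T = v *m (\matrix_(a, b) A (lift ord0 a) (lift ord0 b)) *m v^T.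
Proof.
move=> w; have w0 : w ord0 ord0 = 0 by rewrite mxE unlift_none.
have wl a : w ord0 (lift ord0 a) = v ord0 a by rewrite mxE liftK.
apply/matrixP => i j; rewrite !ord1 !mxE big_ord_recl !mxE unlift_none mulr0 add0r.
apply: eq_bigr => b _; rewrite !mxE liftK; congr (_ * _).
rewrite big_ord_recl w0 mul0r add0r; apply: eq_bigr => a _.
by rewrite wl !mxE.
Qed.

Lemma posdef_lift n (A : 'M[R]_n.+1) : posdef A ->
  posdef (\matrix_(a, b) A (lift ord0 a) (lift ord0 b)).
Proof.
move=> pA v v0; rewrite -mulmx_row_lift; apply: pA.
apply: contraNneq v0 => /rowP H; apply/eqP/rowP => a.
by have := H (lift ord0 a); rewrite !mxE liftK.
Qed.

(** The first row [v] of the inverse satisfies [v *m A = e_0], so the quadratic form of [A] at [v]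
    is the entry in question. *)
Lemma posdef_invmx_gt0 n (A : 'M[R]_n.+1) : A^T = A -> posdef A -> 0 < invmx A ord0 ord0.
Proof.
move=> sA pA; have uA := posdef_unitmx pA.
have E : row ord0 (invmx A) *m A = delta_mx ord0 ord0.
  by rewrite -row_mul mulVmx // row1.
have v0 : row ord0 (invmx A) != 0.
  apply/eqP => v0; move: E; rewrite v0 mul0mx => /matrixP/(_ ord0 ord0).
  by rewrite !mxE !eqxx => /eqP; rewrite eq_sym oner_eq0.
by have := pA _ v0; rewrite E -rowE !mxE.
Qed.

Lemma invmx_congruence n (P A B : 'M[R]_n) : B \in unitmx -> B = P *m A *m P^T ->
  P^T *m invmx B *m P = invmx A.
Proof.
move=> uB BE; have : invmx B *m P *m A *m P^T = 1%:M.
  by rewrite -!mulmxA [P *m (A *m P^T)]mulmxA -BE mulVmx.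
(* A one-sided inverse of a square matrix is two-sided: with [P^T] moved to the front, the identity
   exhibits a left inverse of [A]. *)
move=> /mulmx1C; rewrite !mulmxA => E.
have [_ uA] := mulmx1_unit E.
by rewrite -[LHS]mulmx1 -(mulmxV uA) mulmxA E mul1mx.
Qed.

(* First derivatives [dG] of the components of [J *m G *m J^T], where [J] is a
   Jacobian matrix with derivatives [H] and [D r] are the derivatives of [G]. *)
Lemma christoffel_transform n (J G : 'M[R]_n) (D dG : 'I_n -> 'M[R]_n)
    (H : 'I_n -> 'I_n -> 'rV[R]_n) (k k' : 'rV[R]_n) (c : R) (i j : 'I_n) :
  G^T = G -> (forall i j, H i j = H j i) -> c *: (k *m J) = k' ->
  (forall i j l, dG i j l = (H i j *m G *m (row l J)^T) ord0 ord0
     + (row j J *m G *m (H i l)^T) ord0 ord0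
     + \sum_r J i r * (J *m D r *m J^T) j l) ->
  c * (\sum_l k ord0 l * (dG i j l + dG j i l - dG l i j)) =
  2 * (H i j *m G *m k'^T) ord0 ord0 +
  \sum_r \sum_p J i r * J j p *
     \sum_q k' ord0 q * (D r p q + D p r q - D q r p).
Proof.
move=> sG sH kE dGE.
have tr11 (A : 'M[R]_1) : A ord0 ord0 = A^T ord0 ord0 by rewrite mxE.
have symB (u v : 'rV[R]_n) : (u *m G *m v^T) ord0 ord0 = (v *m G *m u^T) ord0 ord0.
  by rewrite tr11 !trmx_mul trmxK sG mulmxA.
have rowE (u : 'rV[R]_n) l : (u *m (row l J)^T) ord0 ord0 = (u *m J^T) ord0 l.
  by rewrite !mxE; apply: eq_bigr => q _; rewrite !mxE.
(* By [kE], contracting the index [l] with [k] and scaling by [c] absorbs the factor [J] carrying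
   that index and leaves a contraction with [k']. *)
have S1 (z : 'rV[R]_n) : c * (\sum_l k ord0 l * (z *m J^T) ord0 l) = (z *m k'^T) ord0 ord0.
  rewrite tr11 trmx_mul trmxK -kE -scalemxAl mxE -mulmxA; congr (_ * _).
  rewrite mxE; apply: eq_bigr => l _; congr (_ * _).
  by rewrite !mxE; apply: eq_bigr => q _; rewrite !mxE mulrC.
have S2 (X : 'I_n -> R) : c * (\sum_l k ord0 l * \sum_r J l r * X r) = \sum_r k' ord0 r * X r.
  rewrite -kE mulr_sumr.
  under [RHS]eq_bigr do rewrite !mxE -mulrA mulr_suml mulr_sumr.
  rewrite exchange_big /=; apply: eq_bigr => l _.
  rewrite -mulr_sumr; congr (_ * _).
  by rewrite mulr_sumr; apply: eq_bigr => r _; rewrite mulrA.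
pose Q i j l := \sum_r J i r * (J *m D r *m J^T) j l.
(* Of the six terms with second derivatives, four cancel in pairs by the symmetry of [G] and [H];
   the other two are equal and give the factor [2]. *)
have split3 l : dG i j l + dG j i l - dG l i j =
    2 * (H i j *m G *m J^T) ord0 l + Q i j l + Q j i l - Q l i j.
  have b1 : (H l i *m G *m (row j J)^T) ord0 ord0 = (row j J *m G *m (H i l)^T) ord0 ord0.
    by rewrite symB sH.
  rewrite !dGE b1 (sH j i) (sH l j) !rowE -/(Q i j l) -/(Q j i l) -/(Q l i j).
  by clear; ring.
under eq_bigr => l _ do rewrite split3 mulrBr !mulrDr mulrCA.
rewrite sumrB !big_split /= -mulr_sumr mulrBr !mulrDr [c * (2 * _)]mulrCA S1.
have SQ i' j' : c * (\sum_l k ord0 l * Q i' j' l) =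
    \sum_r \sum_p J i' r * J j' p * \sum_q k' ord0 q * D r p q.
  have -> : \sum_l k ord0 l * Q i' j' l =
      \sum_l k ord0 l * ((\sum_r J i' r *: (row j' J *m D r)) *m J^T) ord0 l.
    apply: eq_bigr => l _; congr (_ * _); rewrite mulmx_suml summxE.
    apply: eq_bigr => r _; rewrite -scalemxAl [RHS]mxE; congr (_ * _).
    by rewrite -!row_mul [RHS]mxE.
  rewrite S1 mulmx_suml summxE; apply: eq_bigr => r _.
  rewrite -scalemxAl mxE -mulmxA mxE mulr_sumr; apply: eq_bigr => p _.
  rewrite mxE mulrA; congr (_ * _).
  by rewrite mxE; apply: eq_bigr => q _; rewrite mxE mulrC.
rewrite !SQ S2 -!addrA; congr (_ + _).
have -> : \sum_r \sum_p J j r * J i p * (\sum_q k' ord0 q * D r p q) =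
    \sum_r \sum_p J i r * J j p * (\sum_q k' ord0 q * D p r q).
  rewrite exchange_big /=; apply: eq_bigr => r _; apply: eq_bigr => p _.
  by rewrite [J j p * _]mulrC.
have -> : \sum_r k' ord0 r * (J *m D r *m J^T) i j =
    \sum_r \sum_p J i r * J j p * (\sum_q k' ord0 q * D q r p).
  transitivity (\sum_q \sum_p \sum_r J i r * J j p * (k' ord0 q * D q r p)).
    apply: eq_bigr => q _; rewrite mxE mulr_sumr; apply: eq_bigr => p _.
    rewrite !mxE mulr_suml mulr_sumr; apply: eq_bigr => r _; by clear; ring.
  rewrite exchange_big /=.
  under eq_bigr do rewrite exchange_big /=.
  rewrite exchange_big /=; apply: eq_bigr => r _; apply: eq_bigr => p _.
  by rewrite mulr_sumr.
rewrite -!sumrN -!big_split /=; apply: eq_bigr => r _.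
rewrite -!sumrN -!big_split /=; apply: eq_bigr => p _.
rewrite -mulrN -!mulrDr -sumrN -!big_split /=; congr (_ * _); apply: eq_bigr => q _.
by rewrite mulrBr mulrDr addrA.
Qed.
End LinearAlgebra.

(** * Mean curvature in a single chart *)

Section LocalMeanCurvature.
Context {R : realType} {m : nat}.
Local Notation V := 'rV[R]_m.+1.
Implicit Types (G : V -> 'M[R]_m.+1) (A B : set V) (x y : V).

Definition normal_christoffel G x : 'M[R]_m :=
  \matrix_(a, b) christoffel G x ord0 (lift ord0 a) (lift ord0 b).

(* A positive multiple of the mean curvature that is free of square roots. *)
Definition trace_christoffel G x : R :=
  \tr (invmx (boundary_metric G x) *m normal_christoffel G x).

(** Lowering the index of the outward normal gives [- dx^0] divided by its norm, so only the symbols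
    with upper index [0] survive in the second fundamental form, with a positive sign. *)
Lemma local_mean_curvatureE G x : (G x)^T = G x -> posdef (G x) ->
  local_mean_curvature G x =
  m%:R^-1 * (Num.sqrt (invmx (G x) ord0 ord0))^-1 * trace_christoffel G x.
Proof.
move=> sG pG; set s := Num.sqrt _.
have -> : local_mean_curvature G x = m%:R^-1 * \tr (shape_operator G x) by [].
rewrite -mulrA; congr (_ * _); rewrite /trace_christoffel -linearZ /=; congr (\tr _).
rewrite /shape_operator scalemxAr; congr (_ *m _); apply/matrixP => a b; rewrite !mxE.
have nuE l : \sum_k G x k l * outward_normal G x k = - (s^-1 * (l == ord0)%:R).
  transitivity (- (s^-1 * (G x *m invmx (G x)) l ord0)); last first.
    by rewrite mulmxV ?posdef_unitmx // mxE.
  rewrite mxE mulr_sumr -sumrN; apply: eq_bigr => k _.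
  have -> : G x k l = G x l k by rewrite -[in LHS]sG mxE.
  by rewrite /outward_normal -/s mulrN; congr (- _); rewrite mulrA mulrC.
rewrite exchange_big -sumrN /=.
under eq_bigr => l _ do rewrite -mulr_suml nuE mulNr opprK.
rewrite big_ord_recl big1 ?addr0 => [|l _]; first by rewrite eqxx mulr1.
by rewrite mulr0 mul0r.
Qed.

Lemma local_mean_curvature_gt0 G x : (0 < m)%N -> (G x)^T = G x -> posdef (G x) ->
  0 < trace_christoffel G x -> 0 < local_mean_curvature G x.
Proof.
move=> m0 sG pG T0; rewrite local_mean_curvatureE // !mulr_gt0 ?invr_gt0 ?ltr0n //.
by rewrite sqrtr_gt0 posdef_invmx_gt0.
Qed.

Lemma boundary_metric_posdef G x : posdef (G x) -> posdef (boundary_metric G x).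
Proof. exact: posdef_lift. Qed.

(** Only the term differentiating [G a b] in the normal direction meets a nonzero derivative of
    [lam]. It changes [Gamma^0_ab] by a multiple of the boundary metric, whose trace against its own
    inverse is [m]. *)
Lemma trace_christoffel_conformal A G (lam : V -> R) x :
  half_open A -> A x -> smooth_on A lam -> (forall i j, smooth_on A (fun y => G y i j)) ->
  posdef (G x) -> lam x = 1 -> (forall i, i != ord0 -> pderiv i lam x = 0) ->
  trace_christoffel (fun y => lam y *: G y) x =
  trace_christoffel G x - m%:R / 2 * invmx (G x) ord0 ord0 * pderiv ord0 lam x.
Proof.
move=> hA Ax slam sG pG lam1 dlam.
pose c := 2^-1 * invmx (G x) ord0 ord0 * pderiv ord0 lam x.
have dE i j l : pderiv l (fun y => (lam y *: G y) i j) x =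
    pderiv l lam x * G x i j + pderiv l (fun y => G y i j) x.
  have -> : (fun y => (lam y *: G y) i j) = (fun y => lam y * G y i j).
    by apply/funext => y; rewrite mxE.
  by rewrite (pderivM l hA Ax slam (sG i j)) lam1 mul1r.
have NE : normal_christoffel (fun y => lam y *: G y) x =
    normal_christoffel G x - c *: boundary_metric G x.
  apply/matrixP => a b; rewrite !mxE /christoffel lam1 scale1r.
  under eq_bigr => l _ do
    rewrite !dE (dlam (lift ord0 a)) // (dlam (lift ord0 b)) // !mul0r !add0r.
  have E (l : 'I_m.+1) (p q r : R) : invmx (G x) ord0 l *
      (p + q - (pderiv l lam x * G x (lift ord0 a) (lift ord0 b) + r)) =
      invmx (G x) ord0 l * (p + q - r) -
      invmx (G x) ord0 l * pderiv l lam x * G x (lift ord0 a) (lift ord0 b).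
    by clear; ring.
  under eq_bigr => l _ do rewrite E.
  rewrite sumrB mulrBr; congr (_ - _).
  rewrite big_ord_recl big1 ?addr0 => [|l _]; first by rewrite /c !mulrA.
  by rewrite dlam // mulr0 mul0r.
have BE : boundary_metric (fun y => lam y *: G y) x = boundary_metric G x.
  by apply/matrixP => a b; rewrite !mxE lam1 mul1r.
rewrite /trace_christoffel NE BE mulmxBr -scalemxAr linearB linearZ /=.
rewrite mulVmx ?posdef_unitmx //; last exact: boundary_metric_posdef.
rewrite mxtrace1 /c; congr (_ - _); clear; ring.
Qed.

(** The product rule, arranged as in the hypothesis on [dG] of [christoffel_transform]. *)
Lemma pderiv_congruence A (J K : V -> 'M[R]_m.+1) i x j l : half_open A -> A x ->
  (forall i j, smooth_on A (fun y => J y i j)) ->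
  (forall i j, smooth_on A (fun y => K y i j)) ->
  pderiv i (fun y => (J y *m K y *m (J y)^T) j l) x =
  ((\row_p pderiv i (fun y => J y j p) x) *m K x *m (row l (J x))^T) ord0 ord0 +
  (row j (J x) *m K x *m (\row_p pderiv i (fun y => J y l p) x)^T) ord0 ord0 +
  (J x *m (\matrix_(p, q) pderiv i (fun y => K y p q) x) *m (J x)^T) j l.
Proof.
move=> hA Ax sJ sK.
have -> : (fun y => (J y *m K y *m (J y)^T) j l) =
    (fun y => \sum_q (\sum_p J y j p * K y p q) * J y l q).
  by apply/funext => y; rewrite mxE; apply: eq_bigr => q _; rewrite !mxE.
have s1 q p : smooth_on A (fun y => J y j p * K y p q) by exact: smooth_onM.
have s2 q : smooth_on A (fun y => \sum_p J y j p * K y p q) by exact: smooth_on_sum.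
rewrite (pderiv_sum _ _ i hA Ax) => [|q]; last exact: smooth_onM.
under eq_bigr => q _.
  rewrite (pderivM i hA Ax (s2 q) (sJ l q)) (pderiv_sum _ _ i hA Ax (s1 q)).
  under eq_bigr do rewrite (pderivM i hA Ax (sJ _ _) (sK _ _)).
  rewrite big_split /= mulrDl -addrA [X in _ + X]addrC addrA.
  over.
rewrite !big_split /= !mxE; congr (_ + _ + _); apply: eq_bigr => q _; rewrite !mxE.
- by congr (_ * _); apply: eq_bigr => p _; rewrite !mxE.
- by congr (_ * _); apply: eq_bigr => p _; rewrite !mxE.
- by congr (_ * _); apply: eq_bigr => p _; rewrite !mxE.
Qed.

End LocalMeanCurvature.

(** * Christoffel symbols under a change of coordinates *)

Section ChangeOfChart.
Context {R : realType} {m : nat}.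
Local Notation V := 'rV[R]_m.+1.
Implicit Types (G : V -> 'M[R]_m.+1) (A B : set V) (x y : V).

(** The tangential rows of [J] have no normal entry, so the normal row and column of [M] do not
    reach the tangential block. *)
Lemma congruence_lift n (J M : 'M[R]_n.+1) : (forall a, J (lift ord0 a) ord0 = 0) ->
  let sub (N : 'M[R]_n.+1) := \matrix_(a, b) N (lift ord0 a) (lift ord0 b) in
  sub (J *m M *m J^T) = sub J *m sub M *m (sub J)^T.
Proof.
move=> J0 sub; apply/matrixP => a b; rewrite !mxE big_ord_recl !mxE J0 mulr0 add0r.
apply: eq_bigr => d _; rewrite !mxE big_ord_recl J0 mul0r add0r; congr (_ * _).
by apply: eq_bigr => e _; rewrite !mxE.
Qed.

(** As [Y] preserves the boundary, the differential of its normal component at [x] is [c] times that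
    of the normal coordinate. This [c] is nonnegative because the normal component of [Y] is minimal
    at [x], and nonzero because the Jacobian is invertible. *)
Lemma trace_christoffel_transform A B G G' (Y : V -> V) x :
  let J y : 'M[R]_m.+1 := \matrix_(i, k) pderiv i (fun z => Y z ord0 k) y in
  half_open A -> half_open B -> A x -> (forall y, A y -> B (Y y)) ->
  (forall k, smooth_on A (fun y => Y y ord0 k)) ->
  (forall i j, smooth_on A (fun y => G y i j)) ->
  (forall i j, smooth_on B (fun y => G' y i j)) ->
  (forall y, A y -> G y = J y *m G' (Y y) *m (J y)^T) ->
  (forall y, B y -> (G' y)^T = G' y) -> posdef (G x) ->
  x ord0 ord0 = 0 -> (forall y, A y -> y ord0 ord0 = 0 -> Y y ord0 ord0 = 0) ->
  exists2 c, 0 < c & c * trace_christoffel G x = trace_christoffel G' (Y x).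
Proof.
move=> J hA hB Ax YAB sY sG sG' GE symG' pG x0 Y0.
have JE y i k : J y i k = pderiv i (fun z => Y z ord0 k) y by rewrite mxE.
have sJ i k : smooth_on A (fun y => J y i k).
  by apply: smooth_on_congr (smooth_on_pderiv i hA (sY k)) => y _; rewrite JE.
have sK p q : smooth_on A (fun y => G' (Y y) p q).
  exact: (smooth_on_comp YAB sY (sG' p q)).
have Y0x : Y x ord0 ord0 = 0 by exact: Y0.
have dY0 y a : A y -> y ord0 ord0 = 0 -> pderiv (lift ord0 a) (fun z => Y z ord0 ord0) y = 0.
  by move=> Ay y0; exact: (pderiv_tangential0 hA Ay (sY ord0) Y0 y0).
have J0 a : J x (lift ord0 a) ord0 = 0 by rewrite JE dY0.
have c_ge0 : 0 <= J x ord0 ord0.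
  rewrite JE; apply: (pderiv_min_ge0 _ hA Ax (sY ord0)) => y Ay.
  by rewrite Y0x; exact: half_open_half_space hB (YAB _ Ay).
have uG := posdef_unitmx pG.
have [uJ uG'] : J x \in unitmx /\ G' (Y x) \in unitmx.
  by move: uG; rewrite (GE x Ax) !unitmx_mul => /andP[/andP[]].
set c := J x ord0 ord0 in c_ge0 *.
have colJ : col ord0 (J x) = c *: delta_mx ord0 ord0.
  apply/colP => i; rewrite !mxE; case: (unliftP ord0 i) => [a ->|->].
    by rewrite dY0 //= mulr0.
  by rewrite eqxx mulr1 /c JE.
have c_neq0 : c != 0.
  apply/eqP => c0; have := congr1 (col ord0) (mulVmx uJ).
  rewrite colE -mulmxA -colE colJ c0 scale0r mulmx0 => /colP/(_ ord0).
  by rewrite !mxE eqxx => /eqP; rewrite eq_sym oner_eq0.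
have invE := invmx_congruence uG (GE x Ax).
pose k := row ord0 (invmx (G x)); pose k' := row ord0 (invmx (G' (Y x))).
(* The first row of [(J x)^T] is [c] times a basis vector, so the transformation law of the inverse
   metric relates the two first rows. *)
have kE : c *: (k *m J x) = k'.
  rewrite /k' -invE -mulmxA row_mul -tr_col colJ linearZ /= trmx_delta.
  by rewrite -scalemxAl -rowE row_mul.
pose H i j : 'rV[R]_m.+1 := \row_p pderiv i (fun y => J y j p) x.
pose D r : 'M[R]_m.+1 := \matrix_(p, q) pderiv r (fun z => G' z p q) (Y x).
pose dG i : 'M[R]_m.+1 := \matrix_(j, l) pderiv i (fun y => G y j l) x.
have sH i j : H i j = H j i.
  apply/rowP => p; rewrite !mxE.
  have E a : (fun y => J y a p) = pderiv a (fun z => Y z ord0 p).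
    by apply/funext => y; rewrite JE.
  by rewrite !E (pderivC i j hA Ax (sY p)).
have dGE i j l : dG i j l = (H i j *m G' (Y x) *m (row l (J x))^T) ord0 ord0
    + (row j (J x) *m G' (Y x) *m (H i l)^T) ord0 ord0
    + \sum_r J x i r * (J x *m D r *m (J x)^T) j l.
  rewrite [LHS]mxE.
  have -> : pderiv i (fun y => G y j l) x =
      pderiv i (fun y => (J y *m G' (Y y) *m (J y)^T) j l) x.
    by apply: (pderiv_congr i hA Ax _ (sG j l)) => y Ay; rewrite GE.
  rewrite (pderiv_congruence i j l hA Ax sJ sK); congr (_ + _).
  have -> : (\matrix_(p, q) pderiv i (fun y => G' (Y y) p q) x) = \sum_r J x i r *: D r.
    apply/matrixP => p q; rewrite mxE summxE (pderiv_comp i hA hB Ax YAB sY (sG' p q)).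
    by apply: eq_bigr => r _; rewrite !mxE.
  rewrite mulmx_sumr mulmx_suml summxE; apply: eq_bigr => r _.
  by rewrite -scalemxAr -scalemxAl [LHS]mxE.
pose Chr : 'M[R]_m.+1 := \matrix_(r, p) christoffel G' (Y x) ord0 r p.
have chrE a b : c * normal_christoffel G x a b =
    (J x *m Chr *m (J x)^T) (lift ord0 a) (lift ord0 b).
  have T := christoffel_transform (lift ord0 a) (lift ord0 b) (symG' _ (YAB _ Ax)) sH kE dGE.
  (* The inhomogeneous term reduces to a second tangential derivative of the normal component of
     [Y]. It is zero because the first tangential derivatives vanish along the whole boundary. *)
  have H0 : (H (lift ord0 a) (lift ord0 b) *m G' (Y x) *m k'^T) ord0 ord0 = 0.
    have -> : G' (Y x) = (G' (Y x))^T by rewrite symG' //; exact: YAB.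
    rewrite -mulmxA -trmx_mul /k' -row_mul mulVmx // row1 trmx_delta -colE !mxE.
    apply: (pderiv_tangential0 hA Ax (sJ _ _)) => // y Ay y0; rewrite JE; exact: dY0.
  rewrite H0 mulr0 add0r in T.
  rewrite mxE /christoffel mulrCA.
  transitivity (2^-1 * (c * \sum_l k ord0 l * (dG (lift ord0 a) (lift ord0 b) l +
      dG (lift ord0 b) (lift ord0 a) l - dG l (lift ord0 a) (lift ord0 b)))).
    by congr (_ * (_ * _)); apply: eq_bigr => l _; rewrite !mxE.
  rewrite T mulr_sumr [RHS]mxE.
  under [RHS]eq_bigr => q _ do rewrite mxE mulr_suml.
  rewrite exchange_big /=; apply: eq_bigr => r _; rewrite mulr_sumr; apply: eq_bigr => p _.
  have -> : (J x)^T p (lift ord0 b) = J x (lift ord0 b) p by rewrite mxE.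
  rewrite mulrCA [RHS]mulrAC; congr (_ * _).
  by rewrite [RHS]mxE; congr (_ * _); apply: eq_bigr => q _; rewrite !mxE.
pose Jb := \matrix_(a, b) J x (lift ord0 a) (lift ord0 b).
have NE : c *: normal_christoffel G x = Jb *m normal_christoffel G' (Y x) *m Jb^T.
  transitivity (\matrix_(a, b) (J x *m Chr *m (J x)^T) (lift ord0 a) (lift ord0 b)).
    by apply/matrixP => a b; rewrite [LHS]mxE chrE [RHS]mxE.
  rewrite (congruence_lift _ J0); congr (_ *m _ *m _).
  by apply/matrixP => a b; rewrite !mxE.
have BE : boundary_metric G x = Jb *m boundary_metric G' (Y x) *m Jb^T.
  by rewrite -(congruence_lift _ J0) -GE.
exists c; first by rewrite lt_def c_neq0.
have uB := posdef_unitmx (boundary_metric_posdef pG).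
(* Cyclicity of the trace brings [Jb^T] to the front, where the congruence collapses to the inverse
   boundary metric of [G']. *)
rewrite /trace_christoffel -linearZ /= scalemxAr NE.
by rewrite !mulmxA mxtrace_mulC !mulmxA (invmx_congruence uB BE).
Qed.

End ChangeOfChart.

(** If [P] failed on the whole space, the complements of the sets satisfying [P] would form a proper
    filter, and the local hypothesis at a cluster point would be contradicted. *)
Lemma compact_induction (T : topologicalType) (P : set T -> Prop) :
  compact [set: T] -> P set0 -> (forall A B, P A -> P B -> P (A `|` B)) ->
  (forall A B, A `<=` B -> P B -> P A) ->
  (forall x : T, exists2 N : set T, nbhs x N & P N) -> P setT.
Proof.
move=> cT P0 PU PS Ploc; apply: contrapT => nPT.
pose F : set_system T := [set A | P (~` A)].
have FF : ProperFilter F.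
  split; first by rewrite /F /= setC0.
  split; first by rewrite /F /= setCT.
    by move=> A B FA FB; rewrite /F /= setCI; exact: PU.
  by move=> A B AB; apply: PS; exact: subsetC.
have [|x [_ clx]] := cT F FF; first by rewrite /F /= setCT.
have [N Nx PN] := Ploc x.
by have [|y [nNy Ny]] := clx (~` N) N _ Nx; first by rewrite /F /= setCK.
Qed.

(** * Topology of charts *)

Section Charts.
Context {R : realType} {m : nat} {M : topologicalType}.
Local Notation V := 'rV[R]_m.+1.
Implicit Types (c : chart R m M) (p q : M) (U : set M) (O W : set V).

Lemma chart_image c U : open U -> exists2 W, open W &
  coord c @` (dom c `&` U) = coord c @` dom c `&` W.
Proof.
move=> oU; have /continuousP/(_ U oU)/open_subspaceP[W oW WE] := param_continuous (c := c).
exists W => //; apply/seteqP; split => [_ [p [dp Up] <-]|_ [[p dp <-] Wp]].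
  split; first by exists p.
  have : ((param c @^-1` U) `&` (coord c @` dom c)) (coord c p).
    by split; [rewrite /= coordK | exists p].
  by rewrite -WE => -[].
exists p => //; split => //.
have : (W `&` (coord c @` dom c)) (coord c p) by split => //; exists p.
by rewrite WE => -[Upp _]; rewrite -(coordK dp); exact: Upp.
Qed.

Lemma half_open_image c U : open U -> half_open (coord c @` (dom c `&` U)).
Proof.
move=> oU; have [W oW ->] := chart_image c oU.
have [Om oOm ->] := coord_image c.
by rewrite -setIA [half_space `&` _]setIC setIA; exists (Om `&` W) => //; exact: openI.
Qed.

Lemma half_open_coord c : half_open (coord c @` dom c).
Proof. by rewrite -[dom c]setIT; apply: half_open_image; exact: openT. Qed.

Lemma chart_preimage c O : open O -> open (dom c `&` coord c @^-1` O).
Proof.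
move=> oO; have /continuousP/(_ O oO)/open_subspaceP[W oW WE] := Defs.coord_continuous (c := c).
by rewrite setIC -WE; apply: openI => //; exact: dom_open.
Qed.

Lemma coord_ge0 c p : dom c p -> 0 <= coord c p ord0 ord0.
Proof.
move=> dp; have [Om _ E] := coord_image c.
have : (coord c @` dom c) (coord c p) by exists p.
by rewrite E => -[].
Qed.

Lemma smooth_on_chart_local c f :
  (forall p, dom c p -> exists U, [/\ open U, U p & smooth_on (coord c @` (dom c `&` U)) f]) ->
  smooth_on (coord c @` dom c) f.
Proof.
move=> H; apply: smooth_on_local => _ [p dp <-].
have [U [oU Up sf]] := H p dp; have [W oW WE] := chart_image c oU.
exists W; split => //; last by rewrite -WE.
have : (coord c @` (dom c `&` U)) (coord c p) by exists p.
by rewrite WE => -[].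
Qed.

End Charts.

(** * Boundary points and curvature in overlapping charts *)

Section ChangeOfCharts.
Context {R : realType} {m : nat} {M : topologicalType} (X : bmanifold R m M).
Local Notation V := 'rV[R]_m.+1.
Implicit Types (c : chart R m M) (p q : M) (g : riemannian_metric X).

Let overlap c c' : set V := coord c @` (dom c `&` dom c').

Lemma half_open_overlap c c' : half_open (overlap c c').
Proof. by apply: half_open_image; exact: dom_open. Qed.

Lemma metric_unitmx g c p : atlas X c -> dom c p -> g c p \in unitmx.
Proof. by move=> ac dp; apply: posdef_unitmx => v; exact: metric_posdef. Qed.

(** The tensor law writes the invertible matrix [g c p] as a product with the Jacobian as a factor,
    so the Jacobian is invertible too. *)
Lemma jacobian_col_neq0 g c c' p : atlas X c -> atlas X c' -> dom c p -> dom c' p ->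
  exists i, jacobian_mx c c' p i ord0 != 0.
Proof.
move=> ac ac' dp dp'; apply: contrapT => nE.
have J0 : col ord0 (jacobian_mx c c' p) = 0.
  apply/colP => i; rewrite [LHS]mxE [RHS]mxE; apply/eqP; apply: contrapT => /negP Ji.
  by apply: nE; exists i.
have := metric_unitmx g ac dp; rewrite (metric_tensor g ac ac' dp dp') !unitmx_mul.
move=> /andP[/andP[uJ _] _]; have := congr1 (col ord0) (mulVmx uJ).
rewrite colE -mulmxA -colE J0 mulmx0 => /colP/(_ ord0).
by rewrite !mxE eqxx => /eqP; rewrite eq_sym oner_eq0.
Qed.

(* In a chart where [p] is interior, a chart that puts [p] on the boundary would
   have a normal coordinate with an interior minimum, hence a degenerate Jacobian. *)
Lemma coord0_eq0 g c c' p : atlas X c -> atlas X c' -> dom c p -> dom c' p ->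
  coord c' p ord0 ord0 = 0 -> coord c p ord0 ord0 = 0.
Proof.
move=> ac ac' dp dp' p0; apply/eqP; rewrite eq_le coord_ge0 // andbT leNgt.
apply/negP => x0; have [i] := jacobian_col_neq0 g ac ac' dp dp'.
rewrite mxE; apply/negP/negPn/eqP.
apply: (pderiv_interior_min i (half_open_overlap c c') _ _ x0); first by exists p.
  exact: (atlas_smooth ac ac').
move=> _ [q [dq dq'] <-]; rewrite /transition !coordK // p0.
exact: coord_ge0.
Qed.

Lemma boundary_coord g c p : atlas X c -> dom c p -> boundary X p -> coord c p ord0 ord0 = 0.
Proof. by move=> ac dp [c' [ac' dp' p0]]; exact: (coord0_eq0 g ac ac' dp dp' p0). Qed.

Lemma smooth_on_metric g c i j : atlas X c ->
  smooth_on (coord c @` dom c) (fun x => g c (param c x) i j).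
Proof. by move=> ac; exact: metric_smooth. Qed.

Lemma trace_christoffel_chart g c c' p : atlas X c -> atlas X c' -> dom c p -> dom c' p ->
  boundary X p ->
  exists2 s, 0 < s & s * trace_christoffel (fun x => g c (param c x)) (coord c p) =
    trace_christoffel (fun x => g c' (param c' x)) (coord c' p).
Proof.
move=> ac ac' dp dp' bp.
have YAB x : overlap c c' x -> overlap c' c (transition c c' x).
  by move=> [q [dq dq'] <-]; exists q => //; rewrite /transition coordK.
have subA : overlap c c' `<=` coord c @` dom c by move=> _ [q [dq _] <-]; exists q.
have subB : overlap c' c `<=` coord c' @` dom c' by move=> _ [q [dq _] <-]; exists q.
have sG i j := smooth_onS subA (smooth_on_metric g i j ac).
have sG' i j := smooth_onS subB (smooth_on_metric g i j ac').
have [|||||s s0 sE] := trace_christoffel_transform (half_open_overlap c c')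
  (half_open_overlap c' c) (ex_intro2 _ _ p (conj dp dp') erefl) YAB
  (atlas_smooth ac ac') sG sG'.
- move=> _ [q [dq dq'] <-]; rewrite /transition !coordK //.
  exact: (metric_tensor g ac ac' dq dq').
- by move=> _ [q [dq dq'] <-]; rewrite coordK // metric_sym.
- by rewrite coordK // => v; exact: metric_posdef.
- exact: (boundary_coord g).
- move=> _ [q [dq dq'] <-] q0; rewrite /transition coordK //.
  by apply: (coord0_eq0 g ac' ac dq' dq q0).
by exists s => //; rewrite sE /transition coordK.
Qed.

End ChangeOfCharts.

(** * Bump functions in coordinates *)

Section CoordinateBump.
Context {R : realType} {m : nat}.
Local Notation V := 'rV[R]_m.+1.
Implicit Types (a x : V) (r : R).

(** For [0 < r], positive exactly on the open Euclidean ball; the squared distance keeps the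
    argument of [flat] polynomial. *)
Definition bump a r x : R := flat 0 (r ^+ 2 - \sum_i (x ord0 i - a ord0 i) ^+ 2).

Lemma bump_ge0 a r x : 0 <= bump a r x.
Proof. exact: flat_ge0. Qed.

Lemma bump_center_gt0 a r : 0 < r -> 0 < bump a r a.
Proof.
move=> r0; apply: flat0_gt0; rewrite big1 ?subr0 ?exprn_gt0 // => i _.
by rewrite subrr expr0n.
Qed.

Lemma bump_supp a r x : 0 < r -> bump a r x != 0 -> forall i, `|x ord0 i - a ord0 i| <= r.
Proof.
move=> r0 bx i; rewrite leNgt; apply: contraNN bx => xi.
rewrite /bump flat_le0 // subr_le0 (bigD1 i) //= -[leLHS]addr0.
rewrite lerD // ?sumr_ge0 // => [|j _]; last exact: sqr_ge0.
by rewrite -[leRHS]real_normK ?num_real // lerXn2r ?nnegrE // ltW.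
Qed.

Lemma smooth_on_bump (A : set V) a r : smooth_on A (bump a r).
Proof.
apply: smooth_on_flat; apply: smooth_onD; first exact: smooth_on_cst.
apply: smooth_onN; apply: smooth_on_sum => i.
have s : smooth_on A (fun x => x ord0 i - a ord0 i).
  by apply: smooth_onD; [exact: smooth_on_coord | exact: smooth_on_cst].
by apply: smooth_on_congr (smooth_onM s s) => x _; rewrite expr2.
Qed.

End CoordinateBump.

(** * Smooth functions on the manifold *)

Section SmoothFunctions.
Context {R : realType} {m : nat} {M : topologicalType} (X : bmanifold R m M).
Local Notation V := 'rV[R]_m.+1.
Implicit Types (c : chart R m M) (p q : M) (u v : M -> R).

Lemma smooth_fun0 : smooth_fun X (fun=> 0).
Proof. by move=> c ac; exact: smooth_on_cst. Qed.

Lemma smooth_funD u v : smooth_fun X u -> smooth_fun X v -> smooth_fun X (fun p => u p + v p).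
Proof. by move=> su sv c ac; exact: smooth_onD (su c ac) (sv c ac). Qed.

Lemma smooth_funZ (k : R) u : smooth_fun X u -> smooth_fun X (fun p => k * u p).
Proof. by move=> su c ac; apply: smooth_onM (su c ac); exact: smooth_on_cst. Qed.

Lemma smooth_fun_exp u : smooth_fun X u -> smooth_fun X (fun p => expR (u p)).
Proof. by move=> su c ac; exact: smooth_on_exp (su c ac). Qed.

(* Continuing a compactly supported function of the coordinates by zero uses
   that compact subsets of the Hausdorff space [M] are closed. *)
Lemma smooth_fun_extend c (f : V -> R) (K : set V) : atlas X c ->
  compact K -> K `<=` coord c @` dom c -> smooth_on (coord c @` dom c) f ->
  (forall x, (coord c @` dom c) x -> f x != 0 -> K x) ->
  smooth_fun X (fun q => if `[< dom c q >] then f (coord c q) else 0).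
Proof.
move=> ac cK Kc sf fK c' ac'.
have clK : closed (param c @` K).
  apply: compact_closed; first exact: (bmanifold_hausdorff X).
  apply: continuous_compact => //.
  exact: continuous_subspaceW Kc (@param_continuous _ _ _ c).
apply: smooth_on_chart_local => q dq'.
have [dq|ndq] := pselect (dom c q).
  exists (dom c); split => //; first exact: dom_open.
  have YB x : (coord c' @` (dom c' `&` dom c)) x -> (coord c @` dom c) (transition c' c x).
    by move=> [q0 [dq0' dq0] <-]; exists q0 => //; rewrite /transition coordK.
  apply: smooth_on_congr (smooth_on_comp YB (atlas_smooth ac' ac) sf).
  by move=> _ [q0 [dq0' dq0] <-] /=; rewrite /transition coordK // asboolT.
exists (~` (param c @` K)); split; first exact: closed_openC.
  move=> [x Kx xq]; apply: ndq; have [q0 dq0 q0x] := Kc x Kx.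
  by rewrite -xq -q0x coordK.
apply: smooth_on_congr (@smooth_on_cst _ _ _ 0) => _ [q0 [dq0' nK] <-] /=.
rewrite coordK //; case: asboolP => // dq0; apply/esym/eqP; apply: contrapT => /negP fq0.
by apply: nK; exists (coord c q0); [apply: fK => //; exists q0 | rewrite coordK].
Qed.

Lemma chart_box c p : dom c p -> exists2 r : R, 0 < r & exists K : set V,
  [/\ compact K, K `<=` coord c @` dom c &
    forall x, half_space x -> (forall i, `|x ord0 i - coord c p ord0 i| <= r) -> K x].
Proof.
move=> dp; have [Om oOm E] := coord_image c; set a := coord c p.
have [Oa ha] : (Om `&` half_space) a by rewrite -E; exists p.
have /nbhs_ballP[r /= r0 rO] := open_nbhs_nbhs (conj oOm Oa).
have r2 : 0 < r / 2 by rewrite divr_gt0.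
exists (r / 2) => //.
(* The normal side of the box is cut off at zero, which keeps the compact set inside the half-space
   when the centre is on or near the boundary. *)
pose lo i := if i == ord0 then Num.max 0 (a ord0 i - r / 2) else a ord0 i - r / 2.
exists [set v : V | forall i, `[lo i, a ord0 i + r / 2]%classic (v ord0 i)]; split.
- apply: (@rV_compact _ _ (fun i => `[lo i, a ord0 i + r / 2]%classic)) => i.
  exact: segment_compact.
- move=> x xK; rewrite E; split.
    apply: rO; apply: ball_rV => // i; have := xK i; rewrite /= in_itv /= /lo => /andP[l u].
    apply: (@le_lt_trans _ _ (r / 2)); last by rewrite ltr_pdivrMr // ltr_pMr // ltr1n.
    have l' : a ord0 i - r / 2 <= x ord0 i.
      by apply: le_trans l; case: ifP => // _; rewrite le_max lexx orbT.
    by rewrite ler_distlC l' u.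
  have := xK ord0; rewrite /= in_itv /= /lo eqxx => /andP[l _]; move: l.
  by rewrite ge_max => /andP[].
- move=> x hx xr i; have := xr i; rewrite ler_distl => /andP[l u].
  rewrite /= in_itv /= u andbT /lo; case: ifP => // /eqP i0; rewrite ge_max l andbT i0.
  exact: hx.
Qed.

(** The factor [x^0] makes the normal derivative along the boundary equal to [b]. The metric
    guarantees that boundary points have normal coordinate zero in the chart [c], whichever chart
    exhibits them as such. *)
Lemma normal_bump (g : riemannian_metric X) c p : atlas X c -> dom c p ->
  exists (w : M -> R) (b : V -> R),
  [/\ smooth_fun X w, forall q, 0 <= w q, forall q, boundary X q -> w q = 0,
      smooth_on (coord c @` dom c) b & 0 < b (coord c p)] /\
      forall x, (coord c @` dom c) x -> w (param c x) = b x * x ord0 ord0.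
Proof.
move=> ac dp; have [r r0 [K [cK Kc rK]]] := chart_box dp.
pose b := bump (coord c p) r; pose f (x : V) := b x * x ord0 ord0.
have sb : smooth_on (coord c @` dom c) b by exact: smooth_on_bump.
exists (fun q => if `[< dom c q >] then f (coord c q) else 0), b; split; last first.
  by move=> _ [q dq <-]; rewrite coordK // asboolT.
split => //.
- apply: (smooth_fun_extend ac cK Kc).
    by apply: smooth_onM => //; exact: smooth_on_coord.
  move=> _ [q dq <-]; rewrite /f mulf_eq0 negb_or => /andP[bq _].
  by apply: rK; [exact: coord_ge0 | exact: bump_supp bq].
- move=> q; case: asboolP => // dq; rewrite mulr_ge0 ?bump_ge0 //; exact: coord_ge0.
- move=> q bq; case: asboolP => // dq.
  by rewrite /f (boundary_coord g ac dq bq) mulr0.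
- exact: bump_center_gt0.
Qed.

End SmoothFunctions.

(** * Continuity of determinants, inverses and the curvature trace *)

Section MatrixLimits.
Context {R : realType} {T : Type} (P : set_system T) {FP : Filter P}.

Lemma cvg_sum_r (I : Type) (r : seq I) (Q : pred I) (f : I -> T -> R) (l : I -> R) :
  (forall k, f k t @[t --> P] --> l k) ->
  \sum_(k <- r | Q k) f k t @[t --> P] --> \sum_(k <- r | Q k) l k.
Proof. by move=> fl; apply: cvg_big => //; exact: add_continuous. Qed.

Lemma cvg_prod_r (I : Type) (r : seq I) (Q : pred I) (f : I -> T -> R) (l : I -> R) :
  (forall k, f k t @[t --> P] --> l k) ->
  \prod_(k <- r | Q k) f k t @[t --> P] --> \prod_(k <- r | Q k) l k.
Proof. by move=> fl; apply: cvg_big => //; exact: mul_continuous. Qed.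

Lemma cvg_det n (F : T -> 'M[R]_n) (L : 'M[R]_n) :
  (forall i j, F t i j @[t --> P] --> L i j) -> \det (F t) @[t --> P] --> \det L.
Proof.
move=> FL; rewrite /determinant; apply: cvg_sum_r => s; apply: cvgM; first exact: cvg_cst.
by apply: cvg_prod_r => i; exact: FL.
Qed.

(** Cramer's rule expresses the entries through determinants. It describes [invmx] at invertible
    matrices only, hence the condition near the limit. *)
Lemma cvg_invmx n (F : T -> 'M[R]_n) (L : 'M[R]_n) i j :
  (forall i j, F t i j @[t --> P] --> L i j) -> L \in unitmx ->
  (\forall t \near P, F t \in unitmx) ->
  invmx (F t) i j @[t --> P] --> invmx L i j.
Proof.
move=> FL uL uF.
have invE (A : 'M[R]_n) : A \in unitmx ->
    invmx A i j = (\det A)^-1 * ((-1) ^+ (j + i) * \det (row' j (col' i A))).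
  by move=> uA; rewrite /invmx uA !mxE.
have dL : \det L != 0 by move: uL; rewrite unitmxE unitfE.
rewrite (invE L uL).
apply: (@cvg_trans _ ((\det (F t))^-1 *
    ((-1) ^+ (j + i) * \det (row' j (col' i (F t)))) @[t --> P])).
  by apply: near_eq_cvg; apply: filterS uF => t uFt; rewrite invE.
apply: cvgM; first by apply: cvgV => //; exact: cvg_det.
apply: cvgM; first exact: cvg_cst.
by apply: cvg_det => a b; rewrite !mxE; under eq_fun do rewrite !mxE; exact: FL.
Qed.

End MatrixLimits.

Lemma cvg_trace_christoffel (R : realType) (m : nat) (A : set 'rV[R]_m.+1)
    (G : 'rV[R]_m.+1 -> 'M[R]_m.+1) x :
  half_open A -> A x -> (forall i j, smooth_on A (fun y => G y i j)) ->
  (forall y, A y -> posdef (G y)) ->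
  trace_christoffel G y @[y --> within A (nbhs x)] --> trace_christoffel G x /\
  invmx (G y) ord0 ord0 @[y --> within A (nbhs x)] --> invmx (G x) ord0 ord0.
Proof.
move=> hA Ax sG pG.
have cG i j := smooth_on_cvg (sG i j) Ax.
have cdG l i j := smooth_on_cvg (smooth_on_pderiv l hA (sG i j)) Ax.
have nearA (Q : set 'rV[R]_m.+1) : (forall y, A y -> Q y) -> \forall y \near within A (nbhs x), Q y.
  by move=> AQ; apply: filterS (withinT A (nbhs_filter x)) => y; exact: AQ.
have cI i j : invmx (G y) i j @[y --> within A (nbhs x)] --> invmx (G x) i j.
  apply: cvg_invmx => //; first exact: posdef_unitmx (pG _ Ax).
  by apply: nearA => y /pG /posdef_unitmx.
have cB a b : invmx (boundary_metric G y) a b @[y --> within A (nbhs x)] -->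
    invmx (boundary_metric G x) a b.
  apply: cvg_invmx => [i j||].
  - by rewrite mxE; under eq_fun do rewrite mxE; exact: cG.
  - exact: posdef_unitmx (boundary_metric_posdef (pG _ Ax)).
  - by apply: nearA => y /pG /boundary_metric_posdef /posdef_unitmx.
split => //; apply: cvg_sum_r => a; rewrite mxE; under eq_fun do rewrite mxE.
apply: cvg_sum_r => b; apply: cvgM => //; rewrite mxE; under eq_fun do rewrite mxE.
apply: cvgM; first exact: cvg_cst.
apply: cvg_sum_r => l; apply: cvgM => //.
by apply: cvgB; first apply: cvgD.
Qed.

(** * Conformal change and the gain in mean curvature *)

Section ConformalChange.
Context {R : realType} {m : nat} {M : topologicalType} (X : bmanifold R m M).
Local Notation V := 'rV[R]_m.+1.
Implicit Types (c : chart R m M) (p q : M) (w : M -> R).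
Variables (g : riemannian_metric X) (kappa : R).
Hypotheses (m_gt0 : (0 < m)%N) (kappa_gt0 : 0 < kappa).

Lemma conformal_factor_smooth w : smooth_fun X w ->
  smooth_fun X (fun p => expR (- kappa * w p)).
Proof. by move=> sw; apply: smooth_fun_exp; exact: smooth_funZ. Qed.

Lemma conformal_metric w : smooth_fun X w ->
  exists gt : riemannian_metric X, forall c p, gt c p = expR (- kappa * w p) *: g c p.
Proof.
move=> sw; pose G c p := expR (- kappa * w p) *: g c p.
have symG c p : atlas X c -> dom c p -> (G c p)^T = G c p.
  by move=> ac dp; rewrite linearZ /= metric_sym.
have pG c p : atlas X c -> dom c p -> forall v : V, v != 0 ->
    0 < (v *m G c p *m v^T) ord0 ord0.
  move=> ac dp v v0; rewrite -scalemxAr -scalemxAl mxE mulr_gt0 ?expR_gt0 //.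
  exact: metric_posdef.
have sG c : atlas X c -> forall i j,
    smooth_on (coord c @` dom c) (fun x => G c (param c x) i j).
  move=> ac i j.
  apply: smooth_on_congr (smooth_onM (conformal_factor_smooth sw ac) (metric_smooth g ac i j)).
  by move=> x _; rewrite [RHS]mxE.
have tG c c' p : atlas X c -> atlas X c' -> dom c p -> dom c' p ->
    G c p = jacobian_mx c c' p *m G c' p *m (jacobian_mx c c' p)^T.
  move=> ac ac' dp dp'; rewrite /G (metric_tensor g ac ac' dp dp').
  by rewrite -scalemxAr -scalemxAl.
by exists (RiemannianMetric symG pG sG tG).
Qed.

(** The derivative along the inward coordinate field, not along the unit normal; it depends on the
    chart. *)
Definition normal_derivative c w q : R := pderiv ord0 (w \o param c) (coord c q).

(* The trace of the Christoffel symbols of the metric [expR (- kappa * w) *: g]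
   at a boundary point, when [w] vanishes on the boundary. *)
Definition conformal_trace c w q : R :=
  trace_christoffel (fun x => g c (param c x)) (coord c q) +
  m%:R / 2 * invmx (g c q) ord0 ord0 * (kappa * normal_derivative c w q).

(** One chart is enough, since the sign of the trace at a boundary point is the same in all charts;
    each boundary piece can then keep its own. *)
Definition bends w q := exists c, [/\ atlas X c, dom c q & 0 < conformal_trace c w q].

Definition boundary_defining w :=
  [/\ smooth_fun X w, forall q, 0 <= w q & forall q, boundary X q -> w q = 0].

Lemma chart_point c q : dom c q -> (coord c @` dom c) (coord c q).
Proof. by exists q. Qed.

Lemma normal_derivative_ge0 c w q : atlas X c -> dom c q -> boundary X q ->
  boundary_defining w -> 0 <= normal_derivative c w q.
Proof.
move=> ac dq bq [sw w0 wb].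
apply: (pderiv_min_ge0 _ (half_open_coord c) (chart_point dq) (sw c ac)) => y _.
by rewrite /= coordK // wb.
Qed.

Lemma normal_derivativeD c w w' q : atlas X c -> dom c q ->
  smooth_fun X w -> smooth_fun X w' ->
  normal_derivative c (fun p => w p + w' p) q = normal_derivative c w q + normal_derivative c w' q.
Proof.
move=> ac dq sw sw'.
exact: (pderivD ord0 (half_open_coord c) (chart_point dq) (sw c ac) (sw' c ac)).
Qed.

Lemma metric_invmx_gt0 c q : atlas X c -> dom c q -> 0 < invmx (g c q) ord0 ord0.
Proof.
move=> ac dq; apply: posdef_invmx_gt0; first exact: metric_sym.
by move=> v; exact: metric_posdef.
Qed.

Lemma boundary_definingD w w' : boundary_defining w -> boundary_defining w' ->
  boundary_defining (fun p => w p + w' p).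
Proof.
move=> [sw w0 wb] [sw' w0' wb']; split; first exact: smooth_funD.
  by move=> q; rewrite addr_ge0.
by move=> q bq; rewrite wb // wb' // addr0.
Qed.

(** In the chart chosen for [w], the trace is affine in the normal derivative with positive slope,
    and [w'] can only increase that derivative. *)
Lemma bendsD w w' q : boundary X q -> boundary_defining w -> boundary_defining w' ->
  bends w q -> bends (fun p => w p + w' p) q.
Proof.
move=> bq bw bw' [c [ac dq T0]]; exists c; split => //; apply: lt_le_trans T0 _.
have [[sw _ _] [sw' _ _]] := (bw, bw').
rewrite /conformal_trace normal_derivativeD // lerD2l ler_wpM2l //.
  by rewrite mulr_ge0 ?divr_ge0 ?ler0n // ltW // metric_invmx_gt0.
by rewrite ler_wpM2l ?(ltW kappa_gt0) // lerDl; exact: normal_derivative_ge0.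
Qed.

Lemma boundary_defining0 : boundary_defining (fun=> 0).
Proof. by split => //; exact: smooth_fun0. Qed.

Lemma bends_near p : exists2 N : set M, nbhs p N & exists2 w, boundary_defining w &
  forall q, N q -> boundary X q -> bends w q.
Proof.
have [c ac dp] := atlas_cover X p.
(* An interior point has a neighbourhood without boundary points, where [w = 0] works vacuously. *)
have [bp|nbp] := pselect (boundary X p); last first.
  have p0 : 0 < coord c p ord0 ord0.
    rewrite lt_def coord_ge0 // andbT; apply/eqP => p0.
    by apply: nbp; exists c.
  exists (dom c `&` coord c @^-1` [set y : V | 0 < y ord0 ord0]).
    apply: open_nbhs_nbhs; split => //.
    exact: chart_preimage (@open_half_space_interior R m).
  exists (fun=> 0); first exact: boundary_defining0.
  by move=> q [dq /=]; move=> + bq; rewrite (boundary_coord g ac dq bq) ltxx.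
have [w [b [[sw w0 wb sb b0] wE]]] := normal_bump g ac dp.
have hA := half_open_coord c.
have ndE (k : R) q : dom c q -> boundary X q ->
    normal_derivative c (fun p => k * w p) q = k * b (coord c q).
  move=> dq bq; have Aq := chart_point dq.
  have -> : normal_derivative c (fun p => k * w p) q = k * normal_derivative c w q.
    exact: (pderivZ k ord0 hA Aq (sw c ac)).
  congr (_ * _); rewrite /normal_derivative (pderiv_congr ord0 hA Aq wE (sw c ac)).
  rewrite (pderivM ord0 hA Aq sb (@smooth_on_coord _ _ _ ord0)).
  by rewrite (pderiv_coord ord0 ord0 hA Aq) (boundary_coord g ac dq bq) mulr0 add0r mulr1.
pose G (x : V) := g c (param c x).
have sG i j : smooth_on (coord c @` dom c) (fun x => G x i j) by exact: smooth_on_metric.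
have pG x : (coord c @` dom c) x -> posdef (G x).
  by move=> [q dq <-]; rewrite /G coordK // => v; exact: metric_posdef.
have [cT cI] := cvg_trace_christoffel hA (chart_point dp) sG pG.
pose T := trace_christoffel G (coord c p).
pose d : R := m%:R / 2 * invmx (G (coord c p)) ord0 ord0 * (kappa * b (coord c p)).
have d0 : 0 < d.
  rewrite /d !mulr_gt0 ?ltr0n ?invr_gt0 // /G coordK //; exact: metric_invmx_gt0.
(* Chosen so that [k * d = |T| + 1], whence the new trace at [p] is at least [1] whatever the sign
   of [T]. *)
pose k : R := (`|T| + 1) / d.
have k0 : 0 <= k by rewrite divr_ge0 ?addr_ge0 // ltW.
(* At boundary points this is [conformal_trace] of [k * w]. The formula makes sense and is
   continuous on the whole chart image, so its positivity spreads from [p] to a neighbourhood. *)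
pose Phi (x : V) : R := trace_christoffel G x +
  m%:R / 2 * invmx (G x) ord0 ord0 * (kappa * (k * b x)).
have Phi0 : 0 < Phi (coord c p).
  have -> : Phi (coord c p) = T + k * d by rewrite /Phi /d; ring.
  have /andP[nT _] : - `|T| <= T <= `|T| by rewrite -ler_norml.
  rewrite /k divfK ?gt_eqF // addrA; apply: lt_le_trans ltr01 _.
  by rewrite lerDr -lerBlDr sub0r.
have cPhi : Phi x @[x --> within (coord c @` dom c) (nbhs (coord c p))] --> Phi (coord c p).
  apply: cvgD => //; apply: cvgM; first by apply: cvgM => //; exact: cvg_cst.
  apply: cvgM; first exact: cvg_cst.
  apply: cvgM; first exact: cvg_cst.
  exact: smooth_on_cvg sb (chart_point dp).
have NPhi : \forall x \near coord c p, (coord c @` dom c) x -> 0 < Phi x.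
  have : \forall x \near within (coord c @` dom c) (nbhs (coord c p)), 0 < Phi x.
    exact: cvgr_gt cPhi _ Phi0.
  by rewrite near_withinE.
pose W := [set x | (coord c @` dom c) x -> 0 < Phi x]^°.
have oW : open W by exact: open_interior.
have Wp : W (coord c p) by exact: NPhi.
have WPhi x : W x -> (coord c @` dom c) x -> 0 < Phi x by exact: interior_subset.
exists (dom c `&` coord c @^-1` W).
  by apply: open_nbhs_nbhs; split => //; exact: chart_preimage.
exists (fun q => k * w q).
  split; [exact: smooth_funZ | by move=> q; rewrite mulr_ge0 |].
  by move=> q bq; rewrite wb // mulr0.
move=> q [dq Wq] bq; exists c; split => //.
rewrite /conformal_trace ndE //.
by have := WPhi _ Wq (chart_point dq); rewrite /Phi /G coordK.
Qed.

Lemma bends_everywhere : compact [set: M] ->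
  exists2 w, boundary_defining w & forall q, boundary X q -> bends w q.
Proof.
move=> cM; pose P (S : set M) := exists2 w, boundary_defining w &
  forall q, S q -> boundary X q -> bends w q.
suff [w bw wP] : P setT by exists w => // q; exact: wP.
apply: compact_induction cM _ _ _ bends_near.
- by exists (fun=> 0) => //; exact: boundary_defining0.
- move=> A B [w bw wP] [w' bw' wP']; exists (fun p => w p + w' p).
    exact: boundary_definingD.
  move=> q [Aq|Bq] bq; first by apply: bendsD => //; exact: wP.
  under [fun p => _]eq_fun do rewrite addrC.
  by apply: bendsD => //; exact: wP'.
- by move=> A B AB [w bw wP]; exists w => // q /AB; exact: wP.
Qed.

(** On the boundary the factor is one with differential [- kappa] times that of [w]; the sign
    cancels the one in the conformal law, so the trace grows with the normal derivative. *)
Lemma trace_christoffel_conformal_metric (gt : riemannian_metric X) w c q :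
  (forall c p, gt c p = expR (- kappa * w p) *: g c p) -> boundary_defining w ->
  atlas X c -> dom c q -> boundary X q ->
  trace_christoffel (fun x => gt c (param c x)) (coord c q) = conformal_trace c w q.
Proof.
move=> gtE [sw w0 wb] ac dq bq.
have hA := half_open_coord c; have Aq := chart_point dq.
have wpq : w (param c (coord c q)) = 0 by rewrite coordK // wb.
pose lam (x : V) := expR (- kappa * w (param c x)).
have slam : smooth_on (coord c @` dom c) lam := conformal_factor_smooth sw ac.
have dlam i : pderiv i lam (coord c q) = - kappa * pderiv i (w \o param c) (coord c q).
  have s1 : smooth_on (coord c @` dom c) (fun x => - kappa * w (param c x)).
    exact: (smooth_funZ (- kappa) sw ac).
  rewrite (pderiv_exp i hA Aq s1) wpq mulr0 expR0 mul1r.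
  exact: (pderivZ (- kappa) i hA Aq (sw c ac)).
have -> : (fun x => gt c (param c x)) = (fun x => lam x *: g c (param c x)).
  by apply/funext => x; rewrite gtE.
rewrite (trace_christoffel_conformal hA Aq slam) //.
- rewrite /conformal_trace dlam coordK // -/(normal_derivative c w q).
  by rewrite mulNr mulrN opprK.
- by move=> i j; exact: smooth_on_metric.
- by rewrite coordK // => v; exact: metric_posdef.
- by rewrite /lam wpq mulr0 expR0.
- move=> i i0; rewrite dlam (pderiv_tangential0 hA Aq (sw c ac) _ _ i0) ?mulr0 //.
    move=> _ [q' dq' <-] q'0; rewrite /= coordK // wb //.
    by exists c.
  exact: (boundary_coord g).
Qed.

End ConformalChange.

Theorem theorem5p3 (R : realType) (m : nat) (hn : (3 <= m.+1)%N)
    (M : topologicalType) (X : bmanifold R m M) (hM : compact [set: M])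
    (g : riemannian_metric X) :
  exists gt : riemannian_metric X,
    conformal g gt /\
    forall (p : M) (c : chart R m M), boundary X p -> atlas X c -> dom c p ->
      0 < mean_curvature gt c p.
Proof.
have m_gt0 : (0 < m)%N by exact: (@leq_trans 2).
(* With [n = m.+1] this is [4 / (n - 2)], positive because [n] is at least three. *)
pose kappa := conformal_p R m - 2.
have kappa_gt0 : 0 < kappa.
  have n2 : 0 < m.+1%:R - 2 :> R by rewrite subr_gt0 ltr_nat.
  rewrite subr_gt0 /conformal_p ltr_pdivlMr // ltr_pM2l // gtrBl; exact: ltr0n.
have [w bw wb] := bends_everywhere g m_gt0 kappa_gt0 hM.
have [sw w_ge0 w0] := bw.
have [gt gtE] := conformal_metric g kappa sw.
exists gt; split.
  exists (fun p => expR (- 1 * w p)); split.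
  - by apply: smooth_fun_exp; exact: smooth_funZ.
  - by move=> p; exact: expR_gt0.
  - move=> c p _ _; rewrite gtE -/kappa; congr (_ *: _).
    by rewrite -expRM; congr expR; ring.
move=> p c bp ac dp; have [c' [ac' dp' T0]] := wb p bp.
(* Positivity is known in the chart [c'] supplied by [bends], while the claim concerns an arbitrary
   chart [c]; the two traces differ by the positive factor [s]. *)
have [s s0 sE] := trace_christoffel_chart gt ac ac' dp dp' bp.
apply: local_mean_curvature_gt0 => //.
- by rewrite coordK // metric_sym.
- by rewrite coordK // => v; exact: metric_posdef.
- rewrite -(pmulr_rgt0 _ s0) sE.
  by rewrite (trace_christoffel_conformal_metric gtE bw ac' dp' bp).
Qed.
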